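(* Let $A=A^0\oplus A^1$ be a commutative superalgebra over a field of characteristic $0$. Let $(K_n)_{n\ge 1}$ be the sequence of rational numbers defined recursively by $$K_1=1,\qquad K_n=\frac{-2}{(n+2)(n-1)}\sum_{i=1}^{n-1}S(n+1,i)\,K_i\quad (n\ge 2),$$ where $S(n+1,i)=\frac{1}{i!}\sum_{j=0}^{i}(-1)^{i-j}\binom{i}{j}j^{n+1}$ are the Stirling numbers of the second kind. Then for every linear operator $f\colon A\to A$ one has, in $D(A)$, $$\sum_{i=1}^{\infty}\Phi^i_f=\exp\left(-\sum_{n=1}^{\infty}K_n\rho_n\right)f .$$
   Context: Superalgebras are associative and $\mathbb{Z}/2$-graded, not necessarily unital; $|a|\in\{0,1\}$ is the parity of a homogeneous element $a$, and commutative means $ab=(-1)^{|a||b|}ba$. Linear operators may be even, odd, or sums of both. Shuffles and signs: for a sequence of homogeneous elements indexed by an ordered finite set, a shuffle of type $(p,q)$ is a permutation $\sigma$ of the $p+q$ indices that is increasing on the first $p$ indices and on the last $q$ indices; $S(p,q)$ (with two arguments written as a set of permutations) denotes the set of these. The Koszul sign of $\sigma$ with respect to $a_1,\dots,a_n$ is $\epsilon(\sigma)=(-1)^\alpha$, where $\alpha$ is the number of pairs $i<j$ with $\sigma(i)>\sigma(j)$ and $|a_{\sigma(i)}||a_{\sigma(j)}|=1$. Higher antibrackets: for $f\colon A\to A$ linear and $n\ge 1$, $\Phi^n_f\colon A^{\odot n}\to A$ is $$\Phi^n_f(a_1,\ldots,a_n)=\sum_{k=1}^n(-1)^{n-k}\sum_{\sigma\in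 S(k,n-k)}\epsilon(\sigma)\,f(a_{\sigma(1)}\cdots a_{\sigma(k)})\,a_{\sigma(k+1)}\cdots a_{\sigma(n)}.$$ $D_n(A)=\mathrm{Hom}^*(A^{\odot n+1},A)$ is the super vector space of all (even and odd) supersymmetric multilinear maps in $n+1$ variables, i.e. exchanging adjacent homogeneous arguments $v,w$ multiplies the value by $(-1)^{|v||w|}$; $D(A)=\prod_{n\ge0}D_n(A)$. For $f\in D_n(A)$, $g\in D_m(A)$ put $$(f\barwedge g)(v_0,\ldots,v_{n+m})=\sum_{\sigma\in S(m+1,n)}\epsilon(\sigma)\,f\big(g(v_{\sigma(0)},\ldots,v_{\sigma(m)}),v_{\sigma(m+1)},\ldots,v_{\sigma(m+n)}\big),$$ and $[f,g]=f\barwedge g-(-1)^{|f||g|}g\barwedge f\in D_{n+m}(A)$ (Nijenhuis–Richardson bracket), extended to $D(A)$ componentwise: $[\sum_i f_i,\sum_j g_j]=\sum_n\sum_{i=0}^n[f_i,g_{n-i}]$. Multiplication operators: $\mu_n\in D_n(A)$, $\mu_n(a_0,\ldots,a_n)=a_0a_1\cdots a_n$; and $\rho_n\colon D(A)\to D(A)$, $\rho_n(\omega)=[\mu_n,\omega]$. Since $\rho_n$ raises the index of $D_\bullet(A)$ by $n$, the exponential is well defined on $D(A)$ (each component is a finite sum). $f$ is viewed as an element of $D_0(A)$, and $\Phi^i_f\in D_{i-1}(A)$. *)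

(* Defs.v *)
From HB Require Import structures.
From mathcomp Require Import all_boot all_order all_algebra all_fingroup.
From mathcomp Require Import boolp functions zify.

Set Implicit Arguments.
Unset Strict Implicit.
Unset Printing Implicit Defensive.

Import GRing.Theory.
Local Open Scope ring_scope.

(* The decomposition A = A^0 (+) A^1 is given by its two projections:
   [part p] is the projection onto A^p ([false] is even, [true] is odd), and
   [part p (part (~~ p) a) = 0] follows from the last two axioms. *)
HB.mixin Record isSuperSpace (F : fieldType) A of GRing.Lmodule F A := {
  part : bool -> A -> A;
  part_is_linear : forall p, linear (part p);
  partK : forall p a, part p (part p a) = part p a;
  part_sum : forall a, part false a + part true a = a
}.

#[short(type="superLmodType")]
HB.structure Definition SuperSpace (F : fieldType) :=
  {A of isSuperSpace F A & GRing.Lmodule F A}.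

Definition homog (F : fieldType) (A : superLmodType F) (p : bool) (a : A) :=
  part p a = a.

(* Associative superalgebras, without a unit. *)
HB.mixin Record isSuperAlgebra (F : fieldType) A of SuperSpace F A := {
  smul : A -> A -> A;
  smul_linearl : forall b, linear (fun a => smul a b);
  smul_linearr : forall a, linear (smul a);
  smulA : associative smul;
  smul_homog : forall p q (a b : A),
    homog p a -> homog q b -> homog (p (+) q) (smul a b)
}.

#[short(type="superAlgType")]
HB.structure Definition SuperAlgebra (F : fieldType) :=
  {A of isSuperAlgebra F A & SuperSpace F A}.

HB.mixin Record isSuperCommutative (F : fieldType) A of SuperAlgebra F A := {
  smulC : forall p q (a b : A), homog p a -> homog q b ->
    smul a b = (-1) ^+ (p && q) *: smul b a
}.

#[short(type="comSuperAlgType")]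
HB.structure Definition ComSuperAlgebra (F : fieldType) :=
  {A of isSuperCommutative F A & SuperAlgebra F A}.

HB.instance Definition _ (F : fieldType) (A : superLmodType F) p :=
  GRing.isLinear.Build F A A _ (@part F A p) (part_is_linear p).

HB.instance Definition _ (F : fieldType) (A : superAlgType F) (a : A) :=
  GRing.isLinear.Build F A A _ (@smul F A a) (smul_linearr a).

(* Shuffles of type (k, N - k), for k <= N. *)
Definition shuffles (N k : nat) : {set 'S_N} :=
  [set s : 'S_N | [forall i : 'I_N, forall j : 'I_N,
    (i < j)%N && ((j < k)%N || (k <= i)%N) ==> (s i < s j)%N]].

(* The exponent alpha of the Koszul sign of [s] with respect to a sequence of
   homogeneous elements of parities [p]. *)
Definition koszul (N : nat) (p : 'I_N -> bool) (s : 'S_N) : nat :=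
  \sum_(i < N) \sum_(j < N | (i < j)%N)
    [&& (s j < s i)%N, p (s i) & p (s j)].

Section RawMaps.
Variables (F : fieldType) (A : superLmodType F).
Implicit Types (N : nat).

Definition upd N (v : {ffun 'I_N -> A}) (i : 'I_N) (x : A) : {ffun 'I_N -> A} :=
  [ffun j => if j == i then x else v j].

Definition multilinear N (h : {ffun 'I_N -> A} -> A) : Prop :=
  forall (i : 'I_N) (v : {ffun 'I_N -> A}) (a : F) (x y : A),
    h (upd v i (a *: x + y)) = a *: h (upd v i x) + h (upd v i y).

Definition permv N (s : 'S_N) (v : {ffun 'I_N -> A}) : {ffun 'I_N -> A} :=
  [ffun i => v (s i)].

Definition supersym_at N (h : {ffun 'I_N -> A} -> A) (i j : 'I_N) : Prop :=
  forall (v : {ffun 'I_N -> A}) (p q : bool), homog p (v i) -> homog q (v j) ->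
    h (permv (tperm i j) v) = (-1) ^+ (p && q) *: h v.

Definition supersymmetric N (h : {ffun 'I_N -> A} -> A) : Prop :=
  forall i j : 'I_N, j = i.+1 :> nat -> supersym_at h i j.

Definition is_symm N : {pred {ffun 'I_N -> A} -> A} :=
  fun h => `[< multilinear h /\ supersymmetric h >].
Arguments is_symm : clear implicits.

Definition homparts N (p : {ffun 'I_N -> bool}) (v : {ffun 'I_N -> A}) :
  {ffun 'I_N -> A} := [ffun i => part (p i) (v i)].

(* [sum_(s in S(k, N - k)) eps(s) h(v_(s 0), ..., v_(s (N - 1)))]: the formula
   for homogeneous arguments, extended multilinearly to all arguments by
   decomposing each of them into its homogeneous parts. *)
Definition shsum N (k : nat) (h : {ffun 'I_N -> A} -> A)
    (v : {ffun 'I_N -> A}) : A :=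
  \sum_(p : {ffun 'I_N -> bool}) \sum_(s in shuffles N k)
    (-1) ^+ koszul p s *: h (permv s (homparts p v)).

(* The component of parity [q] of [h], which shifts the total parity of its
   arguments by [q]. *)
Definition hpart N (q : bool) (h : {ffun 'I_N -> A} -> A)
    (v : {ffun 'I_N -> A}) : A :=
  \sum_(p : {ffun 'I_N -> bool})
    part (q (+) \big[addb/false]_i p i) (h (homparts p v)).

(* [f (g (u_0, ..., u_m), u_(m+1), ..., u_(m+n))] *)
Definition nest n m (f : {ffun 'I_n.+1 -> A} -> A) (g : {ffun 'I_m.+1 -> A} -> A)
    (u : {ffun 'I_(n + m).+1 -> A}) : A :=
  f [ffun j : 'I_n.+1 =>
       if j == ord0 then g [ffun i : 'I_m.+1 => u (inord i)]
       else u (inord (m + j))].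

Lemma homog_part p (a : A) : homog p (part p a).
Proof. exact: partK. Qed.

Lemma part_negb p (a : A) : part p (part (~~ p) a) = 0.
Proof.
have E : part p (part (~~ p) a) + part p (part (~~ p) a) = part p (part (~~ p) a).
  have := congr1 (part p) (part_sum (part (~~ p) a)).
  by case: p => /=; rewrite raddfD /= !partK.
by apply: (addrI (part p (part (~~ p) a))); rewrite addr0.
Qed.

Lemma part_homog_neq p q (a : A) : homog p a -> q != p -> part q a = 0.
Proof.
by move=> <- qp; rewrite (_ : p = ~~ q) ?part_negb //; case: p q qp => [] [].
Qed.

Lemma multilinear0 N (h : {ffun 'I_N -> A} -> A) : multilinear h ->
  forall (v : {ffun 'I_N -> A}) i, v i = 0 -> h v = 0.
Proof.
move=> hl v i vi0.
have e : upd v i 0 = v by apply/ffunP=> j; rewrite ffunE; case: eqP => [->|].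
by have := hl i v (-1) 0 0; rewrite !scaler0 addr0 e scaleN1r addNr.
Qed.

Lemma is_symmP N (h : {ffun 'I_N -> A} -> A) :
  h \in is_symm N <-> multilinear h /\ supersymmetric h.
Proof. by split=> [/asboolP|H] //; apply/asboolP. Qed.

Lemma multilinear_lin N (I : Type) (r : seq I) (P : pred I) (c : I -> F)
    (h : I -> {ffun 'I_N -> A} -> A) : (forall i, P i -> multilinear (h i)) ->
  multilinear (fun v => \sum_(i <- r | P i) c i *: h i v).
Proof.
move=> hl i v a x y; rewrite scaler_sumr -big_split; apply: eq_bigr => k Pk /=.
by rewrite (hl k Pk) scalerDr !scalerA mulrC.
Qed.

Lemma supersym_at_lin N (I : Type) (r : seq I) (P : pred I) (c : I -> F)
    (h : I -> {ffun 'I_N -> A} -> A) i j :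
  (forall k, P k -> supersym_at (h k) i j) ->
  supersym_at (fun v => \sum_(k <- r | P k) c k *: h k v) i j.
Proof.
move=> hs v p q vp vq; rewrite scaler_sumr; apply: eq_bigr => k Pk /=.
by rewrite (hs k Pk v p q vp vq) !scalerA mulrC.
Qed.

Lemma is_symm_submod N : submod_closed (is_symm N).
Proof.
split; first by apply/is_symmP; split=> [i v a x y|i j _ v p q _ _];
  rewrite /= ?scaler0 ?addr0.
move=> a f g /is_symmP[fl fs] /is_symmP[gl gs]; apply/is_symmP.
have E : (a *: f + g) = (fun v => \sum_(b <- [:: true; false])
    (if b then a else 1) *: (if b then f else g) v).
  by apply/funext=> v; rewrite !big_cons big_nil addr0 scale1r.
rewrite E; split=> [|i j ij]; first by apply: multilinear_lin => -[].
by apply: supersym_at_lin => -[] _; [exact: fs | exact: gs].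
Qed.

Lemma homparts_upd N p (v : {ffun 'I_N -> A}) i x :
  homparts p (upd v i x) = upd (homparts p v) i (part (p i) x).
Proof. by apply/ffunP=> j; rewrite !ffunE; case: eqP => [->|]. Qed.

Lemma permv_upd N (s : 'S_N) (v : {ffun 'I_N -> A}) i x :
  permv s (upd v i x) = upd (permv s v) ((s^-1)%g i) x.
Proof. by apply/ffunP=> j; rewrite !ffunE -(inj_eq (@perm_inj _ s) j) permKV. Qed.

Lemma permvM N (s t : 'S_N) (v : {ffun 'I_N -> A}) :
  permv s (permv t v) = permv (s * t)%g v.
Proof. by apply/ffunP=> j; rewrite !ffunE permM. Qed.

Lemma homparts_perm N (p : {ffun 'I_N -> bool}) (s : 'S_N) (v : {ffun 'I_N -> A}) :
  homparts [ffun i => p (s i)] (permv s v) = permv s (homparts p v).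
Proof. by apply/ffunP=> j; rewrite !ffunE. Qed.

Lemma multilinear_permv N (s : 'S_N) (h : {ffun 'I_N -> A} -> A) :
  multilinear h -> multilinear (fun v => h (permv s v)).
Proof. by move=> hl i v a x y; rewrite !permv_upd hl. Qed.

(* Multilinear extension of a family of formulas indexed by parities. *)
Lemma parity_sum_symm N (c : {ffun 'I_N -> bool} -> {ffun 'I_N -> A} -> A) :
  (forall p, multilinear (c p)) ->
  (forall (i j : 'I_N) (p : {ffun 'I_N -> bool}) (w : {ffun 'I_N -> A}), j = i.+1 :> nat -> (forall k, homog (p k) (w k)) ->
     c [ffun k => p (tperm i j k)] (permv (tperm i j) w) =
       (-1) ^+ (p i && p j) *: c p w) ->
  (fun v => \sum_(p : {ffun 'I_N -> bool}) c p (homparts p v)) \in is_symm N.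
Proof.
move=> cl cs; apply/is_symmP; split=> [i v a x y|i j ij v a b va vb] /=.
  rewrite scaler_sumr -big_split; apply: eq_bigr => p _ /=.
  by rewrite !homparts_upd linearP cl.
pose T (p : {ffun 'I_N -> bool}) : {ffun 'I_N -> bool} :=
  [ffun k => p (tperm i j k)].
have TK : involutive T by move=> p; apply/ffunP=> k; rewrite !ffunE tpermK.
rewrite (reindex_inj (inv_inj TK)) scaler_sumr; apply: eq_bigr => p _.
rewrite homparts_perm cs //; last by move=> k; rewrite ffunE; exact: homog_part.
have [->|pa] := eqVneq (p i) a; last first.
  by rewrite (multilinear0 (cl _) (i := i)) ?scaler0 // ffunE (part_homog_neq va).
have [->//|pb] := eqVneq (p j) b.
by rewrite (multilinear0 (cl _) (i := j)) ?scaler0 // ffunE (part_homog_neq vb).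
Qed.

Lemma hpart_symm N q (h : {ffun 'I_N -> A} -> A) :
  h \in is_symm N -> hpart q h \in is_symm N.
Proof.
move=> /is_symmP[hl hs]; rewrite /hpart.
apply: (@parity_sum_symm N (fun p w =>
  part (q (+) \big[addb/false]_i p i) (h w))) => [p i v a x y|i j p w ij wp].
  by rewrite hl linearP.
rewrite (hs i j ij w (p i) (p j)) // linearZ /=; congr (_ *: part (_ (+) _) _).
by rewrite (reindex_inj (@perm_inj _ (tperm i j))); apply: eq_bigr => k _;
  rewrite ffunE tpermK.
Qed.

(* The Koszul exponent, indexed by values rather than positions. *)
Lemma koszulE N (p : 'I_N -> bool) (s : 'S_N) : koszul p s =
  (\sum_(x < N) \sum_(y < N)
     [&& y < x, (s^-1)%g x < (s^-1)%g y, p x & p y])%N.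
Proof.
rewrite /koszul (reindex_inj (@perm_inj _ (s^-1)%g)); apply: eq_bigr => x _.
rewrite big_mkcond (reindex_inj (@perm_inj _ (s^-1)%g)); apply: eq_bigr => y _.
rewrite !permKV; case: ltnP => //=; by rewrite andbF.
Qed.

Lemma tperm_adj_val N (i j x : 'I_N) : nat_of_ord (tperm i j x) =
  if x == i :> nat then nat_of_ord j else
  if x == j :> nat then nat_of_ord i else nat_of_ord x.
Proof.
rewrite permE /= -!val_eqE /=.
by case: ifP => // _; case: ifP.
Qed.

Lemma tperm_adj_lt N (i j x y : 'I_N) : j = i.+1 :> nat -> 
  ~~ ((x == i) && (y == j)) -> ~~ ((x == j) && (y == i)) ->
  (tperm i j x < tperm i j y)%N = (x < y)%N.
Proof.
move=> ij; rewrite !tperm_adj_val -!val_eqE /=.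
by do 4?[case: eqP => /=]; lia.
Qed.

Lemma adj_count N (i j : 'I_N) (B : 'I_N -> 'I_N -> bool) : j = i.+1 :> nat ->
  (\sum_(x < N) \sum_(y < N) ((tperm i j x < tperm i j y) && B x y) + B i j =
   \sum_(x < N) \sum_(y < N) ((x < y) && B x y) + B j i)%N.
Proof.
move=> ij.
have sum1 (a b : 'I_N) (c : bool) :
    (\sum_(x < N) \sum_(y < N) [&& x == a, y == b & c] = c)%N.
  rewrite (bigD1 a) //= [X in (_ + X)%N]big1 ?addn0 => [|x /negPf-> //]; last first.
    by rewrite big1.
  rewrite (bigD1 b) //= big1 ?addn0 ?eqxx // => y /negPf->; by rewrite andbF.
rewrite -[X in (_ + X = _)%N](sum1 i j) -[X in (_ = _ + X)%N](sum1 j i).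
rewrite -!big_split; apply: eq_bigr => x _; rewrite -!big_split.
apply: eq_bigr => y _ /=.
have ji : (i == j) = false by apply/eqP => e; move: ij; rewrite e; lia.
have lt1 : (i < j)%N by rewrite ij.
have lt2 : (j < i)%N = false by rewrite ij; lia.
have [/andP[/eqP-> /eqP->]|nij] := boolP ((x == i) && (y == j)).
  by rewrite tpermL tpermR !eqxx lt1 lt2 ji /= addn0 add0n.
have [/andP[/eqP-> /eqP->]|nji] := boolP ((x == j) && (y == i)).
  by rewrite tpermL tpermR !eqxx lt1 lt2 [j == i]eq_sym ji /= addn0 add0n.
rewrite tperm_adj_lt //.
by rewrite !andbA (negPf nij) (negPf nji).
Qed.

Lemma koszul_tpermL N (p : {ffun 'I_N -> bool}) (s : 'S_N) (i j : 'I_N) :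
  j = i.+1 :> nat -> odd (koszul p (s * tperm i j)%g) =
    odd (koszul [ffun k => p (tperm i j k)] s) (+) (p i && p j).
Proof.
move=> ij; rewrite !koszulE.
pose q k := p (tperm i j k).
pose B y x := [&& (s^-1)%g x < (s^-1)%g y, q x & q y]%N.
have E1 : (\sum_(x < N) \sum_(y < N) [&& y < x, ((s * tperm i j)^-1)%g x <
    ((s * tperm i j)^-1)%g y, p x & p y])%N =
    (\sum_(x < N) \sum_(y < N) ((tperm i j x < tperm i j y) && B x y))%N.
  rewrite [RHS]exchange_big (reindex_inj (@perm_inj _ (tperm i j))) /=.
  apply: eq_bigr => x _; rewrite (reindex_inj (@perm_inj _ (tperm i j))) /=.
  apply: eq_bigr => y _.
  by rewrite invMg tpermV !permM !tpermK.
have E2 : (\sum_(x < N) \sum_(y < N) [&& y < x, (s^-1)%g x < (s^-1)%g y,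
    [ffun k => p (tperm i j k)] x & [ffun k => p (tperm i j k)] y])%N =
    (\sum_(x < N) \sum_(y < N) ((x < y) && B x y))%N.
  rewrite [RHS]exchange_big; apply: eq_bigr => x _; apply: eq_bigr => y _.
  by rewrite !ffunE.
rewrite E1 E2; have /(congr1 odd) := adj_count B ij.
rewrite !oddD => H; apply: (@addIb (odd (B i j))); rewrite H -addbA; congr (_ (+) _).
rewrite /B /q tpermL tpermR !oddb.
have : (s^-1)%g i != (s^-1)%g j :> nat.
  by rewrite val_eqE (inj_eq perm_inj) -val_eqE /= ij; lia.
by case: ltngtP => //= _ _; case: (p i); case: (p j).
Qed.

Lemma koszul_tpermR N (p : {ffun 'I_N -> bool}) (s : 'S_N) (i j : 'I_N) :
  j = i.+1 :> nat -> odd (koszul p (tperm i j * s)%g) =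
    odd (koszul p s) (+) (p (s i) && p (s j)).
Proof.
move=> ij.
pose B x y := [&& s y < s x, p (s x) & p (s y)]%N.
have E1 : (koszul p (tperm i j * s)%g =
    \sum_(x < N) \sum_(y < N) ((tperm i j x < tperm i j y) && B x y))%N.
  rewrite /koszul [RHS](reindex_inj (@perm_inj _ (tperm i j))) /=.
  apply: eq_bigr => x _; rewrite big_mkcond /=.
  rewrite [RHS](reindex_inj (@perm_inj _ (tperm i j))) /=.
  apply: eq_bigr => y _; rewrite !permM !tpermK /B.
  by case: ltnP.
have E2 : (koszul p s = \sum_(x < N) \sum_(y < N) ((x < y) && B x y))%N.
  by apply: eq_bigr => x _; rewrite big_mkcond; apply: eq_bigr => y _; case: ltnP.
rewrite E1 E2; have /(congr1 odd) := adj_count B ij.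
rewrite !oddD => H; apply: (@addIb (odd (B i j))); rewrite H -addbA; congr (_ (+) _).
rewrite /B !oddb.
have : s i != s j :> nat by rewrite val_eqE (inj_eq perm_inj) -val_eqE /= ij; lia.
by case: ltngtP => //= _ _; case: (p (s i)); case: (p (s j)).
Qed.

Lemma shufflesP N k (s : 'S_N) :
  reflect (forall i j : 'I_N, (i < j)%N -> ((j < k)%N || (k <= i)%N) ->
    (s i < s j)%N) (s \in shuffles N k).
Proof.
rewrite inE; apply: (iffP forallP) => [H i j ij b|H i].
  by have /forallP/(_ j)/implyP := H i; rewrite ij b => /(_ isT).
by apply/forallP=> j; apply/implyP=> /andP[ij b]; exact: H.
Qed.

Lemma shuffle_adj N k (s : 'S_N) (i j : 'I_N) : j = i.+1 :> nat ->
  s \in shuffles N k -> (s * tperm i j)%g \notin shuffles N k ->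
  (s^-1)%g j = ((s^-1)%g i).+1 :> nat /\ (s^-1)%g j != k :> nat.
Proof.
move=> ij /shufflesP sS; rewrite inE negb_forall => /existsP[x].
rewrite negb_forall => /existsP[y]; rewrite negb_imply !permM.
move=> /andP[/andP[xy b]] nlt; have sxy := sS x y xy b.
have [/andP[/eqP sx /eqP sy]|nij] := boolP ((s x == i) && (s y == j)); last first.
  case/negP: nlt; rewrite tperm_adj_lt //; apply/negP=> /andP[/eqP sx /eqP sy].
  by move: sxy; rewrite sx sy ij; lia.
rewrite -sx -sy !permK; split; last by apply/eqP => e; move: b xy; rewrite e; lia.
apply/eqP; rewrite eqn_leq xy andbT leqNgt; apply/negP=> lt.
have cN : (x.+1 < N)%N by have := ltn_ord y; lia.
have h1 : (s x < s (Ordinal cN))%N by apply: sS => /=; [lia|move: b lt; lia].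
have h2 : (s (Ordinal cN) < s y)%N by apply: sS => /=; [lia|move: b lt; lia].
by move: h1 h2; rewrite sx sy ij; lia.
Qed.

Lemma shsum_symm N k (h : {ffun 'I_N -> A} -> A) : multilinear h ->
  (forall i j : 'I_N, j = i.+1 :> nat -> j != k :> nat -> supersym_at h i j) ->
  shsum k h \in is_symm N.
Proof.
move=> hl hs; apply: (@parity_sum_symm N (fun p w =>
  \sum_(s in shuffles N k) (-1) ^+ koszul p s *: h (permv s w))).
  by move=> p; apply: multilinear_lin => s _; exact: multilinear_permv.
move=> i j p w ij wp.
pose phi (s : 'S_N) := if (s \in shuffles N k) && ((s * tperm i j)%g \in
  shuffles N k) then (s * tperm i j)%g else s.
have phiK : involutive phi.
  move=> s; rewrite {2}/phi; case: ifPn => [/andP[s1 s2]|/negPf E].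
    by rewrite /phi -mulgA tperm2 mulg1 s1 s2.
  by rewrite /phi E.
have phiS s : (phi s \in shuffles N k) = (s \in shuffles N k).
  by rewrite /phi; case: ifP => // /andP[-> ->].
rewrite [in RHS](reindex_inj (inv_inj phiK)) scaler_sumr; apply: eq_big => [s|s sS].
  by rewrite phiS.
rewrite permvM scalerA -[in LHS]signr_odd -[in RHS](signr_odd _ (koszul _ _)).
rewrite -signr_addb /phi sS /=.
have H := koszul_tpermL p s ij.
case: ifPn => [s2|s2]; first by rewrite H addbC -addbA addbb addbF.
set q := [ffun k => _] in H *.
have [ab bk] := shuffle_adj ij sS s2.
set a := (s^-1)%g i in ab bk *; set b := (s^-1)%g j in ab bk *.
have st : (s * tperm i j)%g = (tperm a b * s)%g.
  by rewrite [RHS]conjgC tpermJ /a /b !permKV.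
rewrite st (koszul_tpermR _ _ ab) /a /b !permKV in H.
rewrite st -permvM (hs a b ab bk _ (p i) (p j)) ?ffunE ?/a ?/b ?permKV //.
rewrite scalerA -signr_addb; congr ((-1) ^+ nat_of_bool _ *: _).
by move: H; case: (odd _); case: (odd _); case: (_ && _).
Qed.

Section Nest.
Variables n m : nat.
Implicit Types (u : {ffun 'I_(n + m).+1 -> A}) (z : A).

Let inn u : {ffun 'I_m.+1 -> A} := [ffun i : 'I_m.+1 => u (inord i)].
Let out u z : {ffun 'I_n.+1 -> A} :=
  [ffun j : 'I_n.+1 => if j == ord0 then z else u (inord (m + j))].

Let inordS (i : 'I_m.+1) : (inord i : 'I_(n + m).+1) = i :> nat.
Proof. by rewrite inordK //; have := ltn_ord i; lia. Qed.

Let inordO (j : 'I_n.+1) : (inord (m + j) : 'I_(n + m).+1) = (m + j)%N :> nat.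
Proof. by rewrite inordK //; have := ltn_ord j; lia. Qed.

Let inn_upd u x y : inn (upd u x y) =
  if (x <= m)%N then upd (inn u) (inord x) y else inn u.
Proof.
apply/ffunP=> i; rewrite !ffunE -val_eqE /= inordS.
case: leqP => xm; rewrite !ffunE -?val_eqE /= ?inordK //.
by case: eqP => // e; have := ltn_ord i; lia.
Qed.

Let out_upd u x y z : out (upd u x y) z =
  if (x <= m)%N then out u z else upd (out u z) (inord (x - m)) y.
Proof.
apply/ffunP=> i; rewrite !ffunE -!val_eqE /= inordO.
case: leqP => xm; rewrite !ffunE -!val_eqE /=.
  by case: eqP => // i0; case: eqP => // e; lia.
rewrite inordK; last by have := ltn_ord x; lia.
do ?[case: eqP => ? //]; exfalso; have := ltn_ord x; have := ltn_ord i; lia.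
Qed.

Let out_val u z : out u z = upd (out u 0) ord0 z.
Proof. by apply/ffunP=> j; rewrite !ffunE; case: eqP. Qed.

Let nestE (f : {ffun 'I_n.+1 -> A} -> A) (g : {ffun 'I_m.+1 -> A} -> A) u :
  nest f g u = f (out u (g (inn u))).
Proof. by []. Qed.

Lemma nest_multilinear (f : {ffun 'I_n.+1 -> A} -> A)
    (g : {ffun 'I_m.+1 -> A} -> A) :
  multilinear f -> multilinear g -> multilinear (nest f g).
Proof.
move=> fl gl x u a y z.
rewrite !nestE !inn_upd !out_upd; case: leqP => _.
  by rewrite gl out_val fl -!out_val.
exact: fl.
Qed.

Let inn_perm u (i j : 'I_(n + m).+1) : j = i.+1 :> nat -> j != m.+1 :> nat ->
  inn (permv (tperm i j) u) =
  if (i < m)%N then permv (tperm (inord i) (inord j)) (inn u) else inn u.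
Proof.
move=> ij jm; apply/ffunP=> k; rewrite !ffunE.
case: ltnP => im; rewrite !ffunE; congr (u _); apply: val_inj.
  have kN := ltn_ord k.
  rewrite /= [RHS]inordS !tperm_adj_val !inordK; try lia.
rewrite /= tperm_adj_val inordS.
by do ?[case: eqP => ?]; have := ltn_ord k; lia.
Qed.

Let out_perm u (i j : 'I_(n + m).+1) z : j = i.+1 :> nat -> j != m.+1 :> nat ->
  out (permv (tperm i j) u) z =
  if (i < m)%N then out u z
  else permv (tperm (inord (i - m)) (inord (j - m))) (out u z).
Proof.
move=> ij jm; have jN := ltn_ord j; apply/ffunP=> k; have kN := ltn_ord k.
case: ltnP => im; rewrite !ffunE.
  case: eqP => // /eqP k0; congr (u _); apply: val_inj.
  rewrite /= tperm_adj_val inordO; rewrite -val_eqE /= in k0.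
  by do ?[case: eqP => ?]; lia.
have E0 : (tperm (inord (i - m)) (inord (j - m)) k == ord0 :> 'I_n.+1) = (k == ord0).
  rewrite -!val_eqE /= tperm_adj_val !inordK; try lia.
  case: (nat_of_ord k =P (i - m)%N) => ?; first by lia.
  by case: (nat_of_ord k =P (j - m)%N) => ?; lia.
rewrite E0; case: eqP => // /eqP k0; congr (u _); apply: val_inj.
rewrite /= inordO !tperm_adj_val !inordK; try lia.
by do ?[case: eqP => ?]; lia.
Qed.

Lemma nest_supersym (f : {ffun 'I_n.+1 -> A} -> A)
    (g : {ffun 'I_m.+1 -> A} -> A) (i j : 'I_(n + m).+1) :
  multilinear f -> supersymmetric f -> supersymmetric g ->
  j = i.+1 :> nat -> j != m.+1 :> nat -> supersym_at (nest f g) i j.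
Proof.
move=> fl fs gs ij jm u p q ui uj; have jN := ltn_ord j.
rewrite !nestE inn_perm // out_perm //.
have ioi (k l : 'I_(n + m).+1) : l = k :> nat -> u k = u l.
  by move=> e; congr (u _); apply: val_inj.
case: ltnP => im.
  rewrite (gs _ _ _ _ p q); first last.
  - by rewrite ffunE (ioi _ j) // inordS inordK; lia.
  - by rewrite ffunE (ioi _ i) // inordS inordK; lia.
  - by rewrite !inordK; lia.
  rewrite out_val -[_ *: _]addr0 fl -out_val [X in _ + X](multilinear0 fl (i := ord0)) ?addr0 //.
  by rewrite ffunE eqxx.
apply: fs; rewrite ?ffunE -?val_eqE /= ?inordK; try lia.
  rewrite ifF; last by apply/eqP; lia.
  by rewrite (ioi _ i) // inordK; lia.
  rewrite ifF; last by apply/eqP; lia.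
  by rewrite (ioi _ j) // inordK; lia.
Qed.

End Nest.

Definition barwedge_fun n m (f : {ffun 'I_n.+1 -> A} -> A)
    (g : {ffun 'I_m.+1 -> A} -> A) : {ffun 'I_(n + m).+1 -> A} -> A :=
  shsum m.+1 (nest f g).

Lemma barwedge_symm n m (f : {ffun 'I_n.+1 -> A} -> A)
    (g : {ffun 'I_m.+1 -> A} -> A) :
  f \in is_symm n.+1 -> g \in is_symm m.+1 ->
  barwedge_fun f g \in is_symm (n + m).+1.
Proof.
move=> /is_symmP[fl fs] /is_symmP[gl gs]; apply: shsum_symm.
  exact: nest_multilinear.
by move=> i j ij jm; exact: nest_supersym.
Qed.
End RawMaps.
Arguments is_symm {F A} N.

HB.instance Definition _ (F : fieldType) (A : superLmodType F) N :=
  GRing.isSubmodClosed.Build F ({ffun 'I_N -> A} -> A) (is_symm N)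
    (is_symm_submod A N).

Record Dn (F : fieldType) (A : superLmodType F) (n : nat) := MkDn {
  Dn_fun :> {ffun 'I_n.+1 -> A} -> A;
  Dn_symm : Dn_fun \in is_symm n.+1
}.

Section DnModule.
Variables (F : fieldType) (A : superLmodType F) (n : nat).

HB.instance Definition _ := [isSub for @Dn_fun F A n].
HB.instance Definition _ := [Choice of Dn A n by <:].
HB.instance Definition _ := [SubChoice_isSubLmodule of Dn A n by <:].

End DnModule.

Definition DA (F : fieldType) (A : superLmodType F) : Type :=
  forall n : nat, Dn A n.

Section DAModule.
Variables (F : fieldType) (A : superLmodType F).

HB.instance Definition _ := gen_eqMixin (DA A).
HB.instance Definition _ := gen_choiceMixin (DA A).

Let addD (f g : DA A) : DA A := fun n => f n + g n.
Let oppD (f : DA A) : DA A := fun n => - f n.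
Let zeroD : DA A := fun _ => 0.
Let scaleD (a : F) (f : DA A) : DA A := fun n => a *: f n.

Let addDA : associative addD.
Proof. by move=> f g h; apply: functional_extensionality_dep => n; exact: addrA. Qed.
Let addDC : commutative addD.
Proof. by move=> f g; apply: functional_extensionality_dep => n; exact: addrC. Qed.
Let add0D : left_id zeroD addD.
Proof. by move=> f; apply: functional_extensionality_dep => n; exact: add0r. Qed.
Let addND : left_inverse zeroD oppD addD.
Proof. by move=> f; apply: functional_extensionality_dep => n; exact: addNr. Qed.

HB.instance Definition _ :=
  GRing.isZmodule.Build (DA A) addDA addDC add0D addND.

Let scaleDA a b f : scaleD a (scaleD b f) = scaleD (a * b) f.
Proof. by apply: functional_extensionality_dep => n; exact: scalerA. Qed.
Let scale1D : left_id 1 scaleD.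
Proof. by move=> f; apply: functional_extensionality_dep => n; exact: scale1r. Qed.
Let scaleDDr : right_distributive scaleD +%R.
Proof. by move=> a f g; apply: functional_extensionality_dep => n; exact: scalerDr. Qed.
Let scaleDDl f : {morph scaleD^~ f : a b / a + b}.
Proof. by move=> a b; apply: functional_extensionality_dep => n; exact: scalerDl. Qed.

HB.instance Definition _ :=
  GRing.Zmodule_isLmodule.Build F (DA A) scaleDA scale1D scaleDDr scaleDDl.

Lemma DA_addE (f g : DA A) n : (f + g) n = f n + g n. Proof. by []. Qed.
Lemma DA_oppE (f : DA A) n : (- f) n = - f n. Proof. by []. Qed.
Lemma DA_zeroE n : (0 : DA A) n = 0. Proof. by []. Qed.
Lemma DA_scaleE a (f : DA A) n : (a *: f) n = a *: f n. Proof. by []. Qed.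

Definition castD m n (e : m = n) (f : Dn A m) : Dn A n :=
  ecast i (Dn A i) e f.

Definition Dpart n (q : bool) (f : Dn A n) : Dn A n :=
  MkDn (hpart_symm q (Dn_symm f)).

Definition barwedge n m (f : Dn A n) (g : Dn A m) : Dn A (n + m) :=
  MkDn (barwedge_symm (Dn_symm f) (Dn_symm g)).

(* The sign (-1)^(|f||g|) is extended bilinearly to non-homogeneous maps. *)
Definition bracketn n m (f : Dn A n) (g : Dn A m) : Dn A (n + m) :=
  barwedge f g - castD (addnC m n)
    (\sum_(p : bool) \sum_(q : bool)
       (-1) ^+ (p && q) *: barwedge (Dpart q g) (Dpart p f)).

Definition bracket (f g : DA A) : DA A := fun n =>
  \sum_(i < n.+1) castD (subnKC (leq_ord i)) (bracketn (f i) (g (n - i)%N)).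

Definition inD n (f : Dn A n) : DA A := fun m =>
  if @eqP _ n m is ReflectT e then castD e f else 0.

(* The sum of the infinite family [u 0, u 1, ...], where [u k] has no component
   of index less than [k], so that the terms with [k > n] do not contribute to
   the component of index [n]. *)
Definition dsum (u : nat -> DA A) : DA A := fun n => \sum_(k < n.+1) u k n.

(* [exp T] for an operator [T] raising the index by at least 1, so that
   [iter k T f] has no component of index less than [k] (for the operators used
   here, this is [iter_rho_comb_low] below). *)
Definition dexp (T : DA A -> DA A) (f : DA A) : DA A :=
  dsum (fun k => (k`!%:R)^-1 *: iter k T f).

End DAModule.

(* The value on the empty sequence is never used: A need not have a unit. *)
Definition sprod (F : fieldType) (A : superAlgType F) (s : seq A) : A :=
  if s is a :: s' then foldl smul a s' else 0.

Section Antibrackets.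
Variables (F : fieldType) (A : comSuperAlgType F).

Definition mu_fun n (v : {ffun 'I_n.+1 -> A}) : A := sprod (codom v).

(* [f (u_1 ... u_k) u_(k+1) ... u_N], for 1 <= k <= N. *)
Definition Phi_term (f : A -> A) N (k : nat) (u : {ffun 'I_N -> A}) : A :=
  sprod (f (sprod (take k (codom u))) :: drop k (codom u)).

(* The antibracket with N arguments. *)
Definition Phi_fun (f : A -> A) N (v : {ffun 'I_N -> A}) : A :=
  \sum_(1 <= k < N.+1) (-1) ^+ (N - k) *: shsum k (Phi_term f k) v.

Lemma foldl_smul_linear (s : seq A) a x y :
  foldl smul (a *: x + y) s = a *: foldl smul x s + foldl smul y s.
Proof. by elim: s x y => //= z s IH x y; rewrite smul_linearl IH. Qed.

Lemma foldl_smulZ (s : seq A) a x : foldl smul (a *: x) s = a *: foldl smul x s.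
Proof.
have foldl0 : foldl smul 0 s = 0.
  by have := foldl_smul_linear s (-1) 0 0; rewrite scaler0 addr0 scaleN1r addNr.
by rewrite -[a *: x]addr0 foldl_smul_linear foldl0 addr0.
Qed.

Lemma sprod_linear (s1 s2 : seq A) a x y : sprod (s1 ++ (a *: x + y) :: s2) =
  a *: sprod (s1 ++ x :: s2) + sprod (s1 ++ y :: s2).
Proof.
case: s1 => [|z s1] /=; first exact: foldl_smul_linear.
by rewrite !foldl_cat /= smul_linearr foldl_smul_linear.
Qed.

Lemma sprod_swap (s1 s2 : seq A) p q x y : homog p x -> homog q y ->
  sprod (s1 ++ y :: x :: s2) = (-1) ^+ (p && q) *: sprod (s1 ++ x :: y :: s2).
Proof.
move=> xp yq; have E : smul y x = (-1) ^+ (p && q) *: smul x y.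
  by rewrite (smulC _ _ _ _ yq xp) andbC.
case: s1 => [|z s1] /=; first by rewrite E foldl_smulZ.
by rewrite !foldl_cat /= -!smulA E linearZ foldl_smulZ.
Qed.

Section PhiTerm.
Variables (f : {linear A -> A}) (k : nat).
Let T (s : seq A) := sprod (f (sprod (take k s)) :: drop k s).

Let take_lt (s1 s2 : seq A) : (size s1 < k)%N -> forall x,
  take k (s1 ++ x :: s2) = s1 ++ x :: take (k - (size s1).+1) s2 /\
  drop k (s1 ++ x :: s2) = drop (k - (size s1).+1) s2.
Proof.
move=> lt x; rewrite take_cat drop_cat ltnNge (ltnW lt) /=.
by have -> : (k - size s1 = (k - (size s1).+1).+1)%N by lia.
Qed.

Let take_ge (s1 s2 : seq A) : (k <= size s1)%N ->
  take k (s1 ++ s2) = take k s1 /\ drop k (s1 ++ s2) = drop k s1 ++ s2.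
Proof.
move=> le; rewrite takel_cat // drop_cat; split=> //; case: ltnP => // ge.
by rewrite [drop k s1]drop_oversize // (_ : k - size s1 = 0)%N ?drop0 //; lia.
Qed.

Let T_linear s1 s2 a x y :
  T (s1 ++ (a *: x + y) :: s2) = a *: T (s1 ++ x :: s2) + T (s1 ++ y :: s2).
Proof.
rewrite /T; have [lt|ge] := ltnP (size s1) k.
  have H := take_lt s2 lt; rewrite !(H _).1 !(H _).2 sprod_linear linearP.
  exact: foldl_smul_linear.
by rewrite !(take_ge _ ge).1 !(take_ge _ ge).2 -!cat_cons sprod_linear.
Qed.

Let T_swap s1 s2 p q x y : homog p x -> homog q y -> (size s1).+1 != k ->
  T (s1 ++ y :: x :: s2) = (-1) ^+ (p && q) *: T (s1 ++ x :: y :: s2).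
Proof.
move=> xp yq nk; rewrite /T; have [lt|ge] := ltnP (size s1) k.
  have H z t := take_lt t lt z; rewrite !(H _ _).1 !(H _ _).2.
  have -> : (k - (size s1).+1 = (k - (size s1).+2).+1)%N by lia.
  by rewrite /= (sprod_swap _ _ xp yq) linearZ foldl_smulZ.
rewrite !(take_ge _ ge).1 !(take_ge _ ge).2 -!cat_cons.
exact: sprod_swap.
Qed.

Let nth_codom N (v : {ffun 'I_N -> A}) (i : 'I_N) : nth 0 (codom v) i = v i.
Proof. by rewrite codomE (nth_map i) ?size_enum_ord // nth_ord_enum. Qed.

Let size_cod N (v : {ffun 'I_N -> A}) : size (codom v) = N.
Proof. by rewrite size_codom card_ord. Qed.

Let codom_upd N (v : {ffun 'I_N -> A}) (i : 'I_N) x :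
  codom (upd v i x) = take i (codom v) ++ x :: drop i.+1 (codom v).
Proof.
have iN := ltn_ord i.
apply: (@eq_from_nth _ 0) => [|t]; rewrite size_cod.
  by rewrite size_cat /= size_take size_drop size_cod iN; lia.
move=> tN; rewrite (nth_codom _ (Ordinal tN)) ffunE -val_eqE /= nth_cat size_take size_cod iN.
case: ltngtP => ti; first by rewrite nth_take // (nth_codom _ (Ordinal tN)).
  rewrite (_ : t - i = (t - i.+1).+1)%N /= ?nth_drop; last by lia.
  by rewrite (_ : i.+1 + _ = Ordinal tN)%N ?nth_codom //=; lia.
by rewrite ti subnn.
Qed.

Let codom_id N (v : {ffun 'I_N -> A}) (i j : 'I_N) : j = i.+1 :> nat ->
  codom v = take i (codom v) ++ v i :: v j :: drop i.+2 (codom v).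
Proof.
move=> ij; have iN := ltn_ord i; have jN := ltn_ord j.
rewrite -{1}(cat_take_drop i (codom v)) (drop_nth 0) ?size_cod // nth_codom.
by rewrite (drop_nth 0) ?size_cod -?ij // nth_codom.
Qed.

Let codom_perm N (v : {ffun 'I_N -> A}) (i j : 'I_N) : j = i.+1 :> nat ->
  codom (permv (tperm i j) v) =
    take i (codom v) ++ v j :: v i :: drop i.+2 (codom v).
Proof.
move=> ij; have iN := ltn_ord i; have jN := ltn_ord j.
rewrite (codom_id (permv (tperm i j) v) ij) ![permv _ _ _]ffunE tpermL tpermR; congr (_ ++ _ :: _ :: _).
  apply: (@eq_from_nth _ 0) => [|t]; rewrite !size_take !size_cod iN // => ti.
  have tN : (t < N)%N by lia.
  rewrite !nth_take // !(nth_codom _ (Ordinal tN)) ffunE; congr (v _).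
  by apply: val_inj; rewrite /= tperm_adj_val /=; do ?case: eqP => ? //; lia.
apply: (@eq_from_nth _ 0) => [|t]; rewrite !size_drop !size_cod // => ti.
have tN : (i.+2 + t < N)%N by lia.
rewrite !nth_drop !(nth_codom _ (Ordinal tN)) ffunE; congr (v _).
by apply: val_inj; rewrite /= tperm_adj_val /=; do ?case: eqP => ? //; lia.
Qed.

Lemma Phi_term_multilinear N : multilinear (@Phi_term f N k).
Proof. by move=> i v a x y; rewrite /Phi_term !codom_upd; exact: T_linear. Qed.

Lemma Phi_term_supersym N (i j : 'I_N) : j = i.+1 :> nat -> j != k :> nat ->
  supersym_at (@Phi_term f N k) i j.
Proof.
move=> ij jk v p q vp vq; rewrite /Phi_term codom_perm //.
rewrite [in RHS](codom_id v ij); apply: T_swap => //.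
by rewrite size_take size_cod ltn_ord -ij.
Qed.

Lemma mu_symm n : @mu_fun n \in is_symm n.+1.
Proof.
apply/is_symmP; split=> [i v a x y|i j ij v p q vp vq]; rewrite /mu_fun.
  by rewrite !codom_upd sprod_linear.
by rewrite codom_perm // [in RHS](codom_id v ij) (sprod_swap _ _ vp vq).
Qed.

End PhiTerm.

Lemma Phi_symm (f : {linear A -> A}) N : @Phi_fun f N \in is_symm N.
Proof.
have -> : @Phi_fun f N =
    \sum_(1 <= k < N.+1) (-1) ^+ (N - k) *: shsum k (@Phi_term f N k).
  by apply/funext => v; rewrite fct_sumE.
apply: rpred_sum => k _; apply: rpredZ; apply: shsum_symm.
  exact: Phi_term_multilinear.
by move=> i j ij jk; exact: Phi_term_supersym.
Qed.

Lemma op_symm (f : {linear A -> A}) :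
  (fun v : {ffun 'I_1 -> A} => f (v ord0)) \in is_symm 1.
Proof.
apply/is_symmP; split=> [i v a x y|i j ij].
  by rewrite [i]ord1 !ffunE eqxx linearP.
by have := ltn_ord j; rewrite ij.
Qed.

(* [mu n] is the product of n + 1 factors. *)
Definition mu n : Dn A n := MkDn (mu_symm n).

(* [Phi f n] is the antibracket with n + 1 arguments, Phi^(n+1)_f. *)
Definition Phi (f : {linear A -> A}) n : Dn A n := MkDn (Phi_symm f n.+1).

Definition opD (f : {linear A -> A}) : Dn A 0 := MkDn (op_symm f).

Definition rho n (w : DA A) : DA A := bracket (inD (mu n)) w.

End Antibrackets.

Section Vanishing.
Variables (F : fieldType).

Lemma castD0 (A : superLmodType F) m n (e : m = n) : castD e (0 : Dn A m) = 0.
Proof. by case: n / e. Qed.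

Lemma inD_neq (A : superLmodType F) n (f : Dn A n) m : n != m -> inD f m = 0.
Proof. by rewrite /inD; case: eqP. Qed.

Lemma inD_eq (A : superLmodType F) n (f : Dn A n) : inD f n = f.
Proof. by rewrite /inD; case: eqP => // e; rewrite (eq_irrelevance e erefl). Qed.

Lemma Dn_ext (A : superLmodType F) n (f g : Dn A n) :
  (forall v, f v = g v) -> f = g.
Proof. by move=> fg; apply: val_inj; apply/funext. Qed.

Lemma Dpart0 (A : superLmodType F) n q : Dpart q (0 : Dn A n) = 0.
Proof.
by apply: Dn_ext => v; rewrite /= /hpart big1 // => p _; rewrite linear0.
Qed.

Lemma barwedge0l (A : superLmodType F) n m (g : Dn A m) :
  barwedge (0 : Dn A n) g = 0.
Proof.
apply: Dn_ext => v; rewrite /= /barwedge_fun /shsum big1 // => p _.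
by rewrite big1 // => s _; rewrite /nest scaler0.
Qed.

Lemma barwedge0r (A : superLmodType F) n m (f : Dn A n) :
  barwedge f (0 : Dn A m) = 0.
Proof.
have /is_symmP[fl _] := Dn_symm f.
apply: Dn_ext => v; rewrite /= /barwedge_fun /shsum big1 // => p _.
rewrite big1 // => s _; rewrite /nest (multilinear0 fl (i := ord0)) ?scaler0 //.
by rewrite ffunE eqxx.
Qed.

Lemma bracketn0l (A : superLmodType F) n m (g : Dn A m) :
  bracketn (0 : Dn A n) g = 0.
Proof.
rewrite /bracketn barwedge0l big1 ?castD0 ?subr0 // => p _.
by rewrite big1 // => q _; rewrite Dpart0 barwedge0r scaler0.
Qed.

Lemma bracketn0r (A : superLmodType F) n m (f : Dn A n) :
  bracketn f (0 : Dn A m) = 0.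
Proof.
rewrite /bracketn barwedge0r big1 ?castD0 ?subr0 // => p _.
by rewrite big1 // => q _; rewrite Dpart0 barwedge0l scaler0.
Qed.

Variable A : comSuperAlgType F.

Lemma rho_low n (w : DA A) k N : (forall m, (m < k)%N -> w m = 0) ->
  (N < n + k)%N -> rho n w N = 0.
Proof.
move=> w0 Nnk; rewrite /rho /bracket big1 // => i _.
have [ni|ni] := eqVneq n i; last by rewrite inD_neq // bracketn0l castD0.
by rewrite [w _]w0 ?bracketn0r ?castD0 //; have := ltn_ord i; lia.
Qed.

(* sum_(n >= 1) c_n rho_n; by [rho_low] the terms dropped by [dsum] vanish. *)
Definition rho_comb (c : nat -> F) (w : DA A) : DA A :=
  dsum (fun n => c n.+1 *: rho n.+1 w).

Lemma rho_comb_low c (w : DA A) k : (forall m, (m < k)%N -> w m = 0) ->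
  forall m, (m < k.+1)%N -> rho_comb c w m = 0.
Proof.
move=> w0 m mk; rewrite /rho_comb /dsum big1 // => n _.
by rewrite DA_scaleE (rho_low (k := k)) ?scaler0 //; lia.
Qed.

Lemma iter_rho_comb_low c (w : DA A) k n : (n < k)%N ->
  iter k (fun w => - rho_comb c w) w n = 0.
Proof.
elim: k n => // k IH n nk.
by rewrite iterS DA_oppE (rho_comb_low _ IH) ?oppr0.
Qed.

End Vanishing.

Definition stirling2 (n i : nat) : rat :=
  (i`!%:R)^-1 * \sum_(j < i.+1) (-1) ^+ (i - j) * 'C(i, j)%:R * j%:R ^+ n.

(* Main.v *)
(* Write E_(k,l) for the symmetrisation of f(a_1 ... a_k) a_(k+1) ... a_(k+l).
   Coassociativity and cocommutativity of the unshuffle coproduct give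
     rho_m E_(k,l) = (C(l+m,m) - C(l+m,m+1)) E_(k,l+m) - C(k+m,m+1) E_(k+m,l).
   Representing E_(k,l) by x^k/k! y^l/l!, the operator -sum K_n rho_n becomes
   V + W with V = v(x) d/dx, W = v(y) d/dy - v'(y), v(x) = sum K_n x^(n+1)/(n+1)!,
   and the claim becomes exp(V) x * exp(W) 1 = (e^x - 1) e^(-y).  The recursion for
   K_n is the Julia equation v(e^x - 1) = e^x v(x).  As exp(V) is multiplicative,
   psi = exp(V) x satisfies v(psi) = v psi', which has the unique solution
   x + x^2/2 + ..., so psi = e^x - 1; exp(W) 1 follows from W v = 0.  Power series
   are polynomials modulo x^M. *)
Require Import Defs.
From HB Require Import structures.
From mathcomp Require Import all_boot all_order all_algebra all_fingroup.
From mathcomp Require Import boolp functions zify ring.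

Set Implicit Arguments.
Unset Strict Implicit.
Unset Printing Implicit Defensive.

Import GRing.Theory.
Local Open Scope ring_scope.

(** * The unshuffle coproduct *)

Section Unshuffle.
Variables (F : fieldType) (A : superLmodType F).
Implicit Types (l a b : seq (bool * A)) (G : seq (bool * A) -> seq (bool * A) -> A).

(** Sums over [shuffles] nest badly: composing two of them needs a bijection of permutations
    together with its signs. Multilinearity therefore reduces everything to words of homogeneous
    letters that carry their parities, where a shuffle sum becomes the recursive [unsh] and the
    coalgebra laws are inductions on the word. The binomials in rho_m E_(k,l) count which letters
    were brought in by mu_m: C(l+m,m) when E_(k,l) is a factor of the product; C(l+m,m+1) and
    C(k+m,m+1) when a product of m+1 letters takes one place of E_(k,l), outside or inside f. The
    E_(k,l) may be linearly dependent, so identities are proved for the weights and then mapped to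
    D(A). The weights are rational and reach the field through the embedding of the rationals.
    Truncation is harmless because V and W raise the order of a series, v being divisible by x^2;
    cancelling v costs two degrees. *)

Definition par l : bool := foldr (fun x q => x.1 (+) q) false l.

Definition allhom l := all (fun x => part x.1 x.2 == x.2) l.

(* The unshuffle coproduct, evaluated on [G]: the letters of [l] are distributed
   over [a] and [b] in all ways, with the Koszul sign of moving [a] to the left. *)
Fixpoint unsh G l : A :=
  if l is x :: l' then
    unsh (fun a b => G (x :: a) b) l' +
    unsh (fun a b => (-1) ^+ (x.1 && par a) *: G a (x :: b)) l'
  else G [::] [::].

Definition split_of l a b :=
  [/\ par a (+) par b = par l, (size a + size b = size l)%N,
      allhom l -> allhom a & allhom l -> allhom b].

Lemma eq_unsh G G' l : (forall a b, split_of l a b -> G a b = G' a b) ->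
  unsh G l = unsh G' l.
Proof.
elim: l G G' => [|x l IH] G G' E /=; first exact: E.
congr (_ + _); apply: IH => a b [pab sab ha hb].
  apply: E; split=> //=; first by rewrite -addbA pab.
  - by rewrite addSn sab.
  - by case/andP=> -> /ha.
  - by case/andP=> _ /hb.
rewrite E //; split=> //=; first by rewrite addbCA pab.
- by rewrite addnS sab.
- by case/andP=> _ /ha.
- by case/andP=> -> /hb.
Qed.

Lemma unsh_sum (I : Type) (r : seq I) (P : pred I) (H : I -> _) l :
  unsh (fun a b => \sum_(i <- r | P i) H i a b) l =
  \sum_(i <- r | P i) unsh (H i) l.
Proof.
elim: l H => //= x l IH H; rewrite big_split /= -!IH; congr (_ + _).
by apply: eq_unsh => a b _; rewrite scaler_sumr.
Qed.

Lemma unshD G G' l : unsh (fun a b => G a b + G' a b) l = unsh G l + unsh G' l.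
Proof.
have := unsh_sum [:: true; false] predT (fun i => if i then G else G') l.
rewrite !big_cons big_nil /= addr0 => <-.
by apply: eq_unsh => a b _; rewrite !big_cons big_nil /= addr0.
Qed.

Lemma linear_unsh (f : A -> A) G l : linear f ->
  f (unsh G l) = unsh (fun a b => f (G a b)) l.
Proof.
move=> fl; have fD x y : f (x + y) = f x + f y.
  by have := fl 1 x y; rewrite !scale1r.
have fZ c x : f (c *: x) = c *: f x.
  have f0 : f 0 = 0 by apply: (addrI (f 0)); rewrite -fD !addr0.
  by have := fl c x 0; rewrite f0 !addr0.
elim: l G => //= x l IH G; rewrite fD !IH; congr (_ + _).
by apply: eq_unsh => a b _; exact: fZ.
Qed.

Lemma unshZ c G l : unsh (fun a b => c *: G a b) l = c *: unsh G l.
Proof.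
elim: l G => //= x l IH G; rewrite scalerDr -!IH; congr (_ + _).
by apply: eq_unsh => a b _; rewrite !scalerA mulrC.
Qed.

Lemma unsh0 l : unsh (fun _ _ => 0) l = 0.
Proof. by have := unshZ 0 (fun _ _ => 0) l; rewrite !scale0r. Qed.

(** Both sides distribute the letters over three words. A letter entering the last word passes [a]
    and [b] together on the left and one after the other on the right; the signs agree because
    [par s] is [par a (+) par b]. *)
Lemma unsh_coassoc (H : _ -> _ -> _ -> A) l :
  unsh (fun s c => unsh (fun a b => H a b c) s) l =
  unsh (fun a r => unsh (fun b c => H a b c) r) l.
Proof.
elim: l H => //= x l IH H; rewrite !unshD IH -addrA; congr (_ + _).
rewrite [RHS](eq_unsh (G' := fun a r => unsh (fun b c => (-1) ^+ (x.1 && par a) *: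
  H a (x :: b) c) r + unsh (fun b c => (-1) ^+ (x.1 && par a) *:
  ((-1) ^+ (x.1 && par b) *: H a b (x :: c))) r)); last first.
  by move=> a r _ /=; rewrite scalerDr -!unshZ.
rewrite unshD -!IH; congr (_ + _); apply: eq_unsh => s c _.
rewrite -unshZ; apply: eq_unsh => a b [<- _ _ _].
by rewrite scalerA -signr_addb; congr ((-1) ^+ nat_of_bool _ *: _); case: (x.1).
Qed.

Lemma unsh_cocomm G l :
  unsh (fun a b => (-1) ^+ (par a && par b) *: G b a) l = unsh G l.
Proof.
elim: l G => //= [G|x l IH G]; first by rewrite scale1r.
rewrite addrC; congr (_ + _); rewrite -[RHS]IH; apply: eq_unsh => a b _ /=.
  rewrite scalerA -signr_addb; congr ((-1) ^+ nat_of_bool _ *: _).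
  by case: (x.1); case: (par a); case: (par b).
rewrite scalerA -signr_addb; congr ((-1) ^+ nat_of_bool _ *: _).
by case: (x.1); case: (par a); case: (par b).
Qed.

Definition superL (G : seq (bool * A) -> A) := forall s1 s2 x y,
  allhom [:: x; y] ->
  G (s1 ++ y :: x :: s2) = (-1) ^+ (x.1 && y.1) *: G (s1 ++ x :: y :: s2).

Lemma superL_move (G : seq (bool * A) -> A) s a x b : superL G ->
  allhom (x :: a) ->
  (-1) ^+ (x.1 && par a) *: G (s ++ a ++ x :: b) = G (s ++ x :: a ++ b).
Proof.
move=> sG; elim: a s => [|y a IH] s /=; first by rewrite andbF scale1r.
move=> /and3P[hx hy ha].
rewrite -[y :: a ++ x :: b]cat1s catA.
have -> : x.1 && (y.1 (+) par a) = (x.1 && y.1) (+) (x.1 && par a) by case: (x.1).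
rewrite signr_addb -scalerA IH /= ?hx // -catA /= sG /= ?hx ?hy //.
by rewrite scalerA -signr_addb addbb scale1r.
Qed.

(** Supersymmetry of [G] cancels the Koszul sign of each choice of [a], so every choice contributes
    [G r]; the induction is Pascal's rule. All binomial coefficients of [wrho] arise here. *)
Lemma unsh_cat (G : seq (bool * A) -> A) j r : superL G -> allhom r ->
  unsh (fun a b => if size a == j then G (a ++ b) else 0) r =
  'C(size r, j)%:R *: G r.
Proof.
move=> sG; elim: r G j sG => [|x r IH] G j sG /=.
  by case: j => [|j] _; rewrite ?scale1r ?scale0r.
move=> /andP[hx hr].
have sG' : superL (fun s => G (x :: s)) by move=> s1 s2; exact: (sG (x :: s1)).
have E2 : unsh (fun a b => (-1) ^+ (x.1 && par a) *:
    (if size a == j then G (a ++ x :: b) else 0)) r = 'C(size r, j)%:R *: G (x :: r).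
  rewrite -(IH _ _ sG' hr); apply: eq_unsh => a b [_ _ ha _].
  case: ifP => _; last by rewrite scaler0.
  by rewrite (@superL_move G [::]) //= hx ha.
rewrite E2; case: j {E2} => [|j].
  by rewrite !bin0 unsh0 add0r.
by rewrite (IH _ j sG' hr) -scalerDl -natrD addnC binS.
Qed.

End Unshuffle.

(** * Shuffles and subsets *)

Section HomogeneousFamilies.
Variables (F : fieldType) (A : superLmodType F).
Implicit Types (l a b : seq (bool * A)).

Definition fam N l : {ffun 'I_N -> A} := [ffun i : 'I_N => (nth (false, 0) l i).2].

(** Arguments are split one by one into their even and odd parts; [j] bounds the positions that may
    still be inhomogeneous. *)
Lemma Dn_ext_hom n (f g : Dn A n) :
  (forall l, size l = n.+1 -> allhom l -> f (fam n.+1 l) = g (fam n.+1 l)) -> f = g.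
Proof.
move=> E; apply: Dn_ext; suff H j : (j <= n.+1)%N -> forall v : {ffun 'I_n.+1 -> A},
    (forall i : 'I_n.+1, (j <= i)%N -> exists p, homog p (v i)) -> f v = g v.
  by move=> v; apply: (H n.+1) => // i; rewrite leqNgt ltn_ord.
have /is_symmP[fl _] := Dn_symm f; have /is_symmP[gl _] := Dn_symm g.
elim: j => [_ v hv|j IH jn v hv].
  have ex i : exists p, part p (v i) == v i.
    by have [//|p /eqP] := hv i; exists p.
  pose q i := xchoose (ex i).
  have -> : v = fam n.+1 [seq (q i, v i) | i <- enum 'I_n.+1].
    apply/ffunP=> i; rewrite ffunE (nth_map i) ?size_enum_ord //.
    by rewrite nth_ord_enum.
  apply: E; first by rewrite size_map size_enum_ord.
  by apply/allP=> _ /mapP[i _ ->] /=; exact: (xchooseP (ex i)).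
have jn' : (j < n.+1)%N by [].
pose i := Ordinal jn'.
have -> : v = upd v i (1 *: part false (v i) + part true (v i)).
  by rewrite scale1r part_sum; apply/ffunP=> k; rewrite ffunE; case: eqP => [->|].
rewrite fl gl; congr (_ *: _ + _); apply: IH (ltnW jn) _ _ => k jk; rewrite ffunE;
  case: eqP => ki; try (eexists; exact: homog_part);
  by apply: hv; rewrite ltn_neqAle jk andbT; apply/eqP => jk'; case: ki; apply: val_inj.
Qed.

(** A parity pattern other than that of [l] produces a zero argument, so a single term of the outer
    sum of [shsum] survives. *)
Lemma shsum_fam N k (h : {ffun 'I_N -> A} -> A) l : multilinear h ->
  size l = N -> allhom l ->
  shsum k h (fam N l) = \sum_(s in shuffles N k)
    (-1) ^+ koszul (fun i => (nth (false, 0) l i).1) s *: h (permv s (fam N l)).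
Proof.
move=> hl sl hom; pose q : {ffun 'I_N -> bool} := [ffun i : 'I_N => (nth (false, 0) l i).1].
have lh i : homog (q i) (fam N l i).
  rewrite !ffunE; apply/eqP; apply: (allP hom); apply: mem_nth; by rewrite sl.
rewrite /shsum (bigD1 q) //= [X in _ + X]big1 ?addr0 => [|p pq]; last first.
  have [i ip] : exists i, p i != q i.
    apply/existsP; rewrite -negb_forall; apply: contraNN pq => /forallP e.
    by apply/eqP/ffunP=> i; apply/eqP.
  apply: big1 => s _; rewrite (multilinear0 hl (i := (s^-1)%g i)) ?scaler0 //.
  by rewrite [LHS]ffunE ffunE permKV (part_homog_neq (lh i)).
apply: eq_bigr => s _; congr ((-1) ^+ _ *: h (permv s _)).
  by apply: eq_bigr => i _; apply: eq_bigr => j _; rewrite !ffunE.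
by apply/ffunP=> i; rewrite ffunE; exact: lh.
Qed.

Section Sets.
Variables (N : nat) (X : 'I_N -> bool * A).
Implicit Types (S : {set 'I_N}) (e : seq 'I_N).

(** The Koszul exponent of moving the letters indexed by [S] to the front. *)
Definition invs e S : nat := (\sum_(x <- e) \sum_(y <- e)
  [&& (x < y)%N, x \notin S, y \in S, (X x).1 & (X y).1])%N.

Lemma par_filter e S : par (map X [seq x <- e | x \in S]) =
  odd (\sum_(y <- e) ((y \in S) && (X y).1))%N.
Proof.
elim: e => [|x e IH] /=; first by rewrite big_nil.
by rewrite big_cons oddD; case: ifP => /= _; rewrite IH ?oddb.
Qed.

Lemma unsh_sets G e : sorted (fun x y : 'I_N => (x < y)%N) e ->
  unsh G (map X e) = \sum_(S : {set 'I_N} | S \subset e)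
    (-1) ^+ invs e S *: G (map X [seq x <- e | x \in S]) (map X [seq x <- e | x \notin S]).
Proof.
have tr : transitive (fun x y : 'I_N => (x < y)%N) by move=> x y z; exact: ltn_trans.
elim: e G => [|x e IH] G se.
  rewrite (big_pred1 set0) => [|S /=].
    by rewrite /invs big_nil scale1r.
  apply/subsetP/eqP => [H|->]; last by move=> y; rewrite inE.
  by apply/setP=> y; rewrite inE; apply/negP=> /H.
have lte y : y \in e -> (x < y)%N.
  by move: se; rewrite /= path_sortedE // => /andP[/allP H _] /H.
have xe : x \notin e by apply/negP=> /lte; rewrite ltnn.
rewrite (bigID (fun S : {set _} => x \in S)) /=.
have {}se : sorted (fun x y : 'I_N => (x < y)%N) e by exact: path_sorted se.
congr (_ + _); rewrite IH //.
  rewrite [RHS](reindex_onto (fun S : {set 'I_N} => x |: S) (fun S => S :\ x)) /=; last first.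
    by move=> S /andP[_ xS]; rewrite setD1K.
  apply: eq_big => [S|S Se].
    rewrite setU11 andbT; apply/idP/andP => [/subsetP H|[/subsetP H /eqP E]].
      split; last by rewrite setU1K //; apply: contraNN xe => /H.
      by apply/subsetP=> y; rewrite !inE => /predU1P[->|/H ->]; rewrite ?eqxx ?orbT.
    apply/subsetP=> y yS; have := H y; rewrite !inE yS orbT => /(_ isT) /predU1P[yx|//].
    by move: yS; rewrite yx -E !inE eqxx.
  have xS : x \notin S by apply: contraNN xe; apply/subsetP.
  rewrite setU11 /= -!map_cons.
  have E y : y \in e -> (y \in x |: S) = (y \in S).
    by rewrite !inE => ye; case: eqP => // yx; rewrite -yx ye in xe.
  have -> : [seq y <- e | y \in x |: S] = [seq y <- e | y \in S].
    exact: eq_in_filter E.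
  have -> : [seq y <- e | y \notin x |: S] = [seq y <- e | y \notin S].
    by apply: eq_in_filter => y /E ->.
  congr ((-1) ^+ _ *: G _ _); rewrite /invs big_cons.
  rewrite [X in (X + _)%N]big1 ?add0n; last first.
    by move=> y _; rewrite setU11 andbF.
  rewrite big_seq [RHS]big_seq; apply: eq_bigr => y ye.
  rewrite big_cons [X in (X + _)%N](_ : _ = 0)%N ?add0n; last first.
    by rewrite ltnNge ltnW ?lte.
  rewrite big_seq [RHS]big_seq; apply: eq_bigr => z ze.
  by rewrite !E.
apply: eq_big => [S|S Se].
  apply/idP/andP => [/subsetP H|[/subsetP H xS]].
    by split; [apply/subsetP=> y /H; rewrite inE orbC => -> | apply: contraNN xe => /H].
  apply/subsetP=> y yS; have := H y yS; rewrite inE => /predU1P[yx|//].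
  by rewrite -yx yS in xS.
have xS : x \notin S by apply: contraNN xe; apply/subsetP.
rewrite (negPf xS) /= scalerA; congr (_ *: _).
rewrite par_filter -[in LHS]signr_odd -signr_addb -[RHS]signr_odd; congr ((-1) ^+ nat_of_bool _).
rewrite /invs big_cons oddD addbC; congr (_ (+) _).
  rewrite big_cons ltnn add0n.
  have -> : (\sum_(y <- e) [&& (x < y)%N, x \notin S, y \in S, (X x).1 & (X y).1])%N =
     ((X x).1 * (\sum_(y <- e) ((y \in S) && (X y).1)))%N.
    rewrite big_distrr /= big_seq [RHS]big_seq; apply: eq_bigr => y ye.
    by rewrite lte // xS /=; case: (y \in S); case: (X x).1; case: (X y).1.
  by rewrite oddM oddb.
rewrite big_seq [in RHS]big_seq; congr odd; apply: eq_bigr => y ye.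
by rewrite big_cons ltnNge ltnW ?lte //= add0n.
Qed.
End Sets.
End HomogeneousFamilies.

Section ShuffleSums.
Variables (F : fieldType) (A : superLmodType F).
Implicit Types (l a b : seq (bool * A)).

Section Shuffles.
Variable N : nat.
Implicit Types (S : {set 'I_N}) (s : 'S_N).
Local Notation ltI := (fun x y : 'I_N => (x < y)%N).

Lemma ltI_trans : transitive ltI.
Proof. by move=> x y z; exact: ltn_trans. Qed.

Lemma ltI_irr : irreflexive ltI.
Proof. by move=> x; exact: ltnn. Qed.

Lemma enum_ltI : sorted ltI (enum 'I_N).
Proof.
have := iota_ltn_sorted 0 N; rewrite -val_enum_ord sorted_map.
by apply: sub_sorted.
Qed.

Lemma filter_ltI (P : pred 'I_N) : sorted ltI (filter P (enum 'I_N)).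
Proof. exact: (sorted_filter ltI_trans) enum_ltI. Qed.

Definition block_enum S :=
  [seq x <- enum 'I_N | x \in S] ++ [seq x <- enum 'I_N | x \notin S].

Lemma block_enum_perm S : perm_eq (block_enum S) (enum 'I_N).
Proof. exact/permPl/perm_filterC. Qed.

Lemma size_block_enum S : size (block_enum S) = N.
Proof. by rewrite (perm_size (block_enum_perm S)) size_enum_ord. Qed.

Lemma block_enum_inj S : injective (fun i : 'I_N => nth i (block_enum S) i).
Proof.
move=> i j /eqP; rewrite (set_nth_default i) ?size_block_enum //.
rewrite nth_uniq ?size_block_enum // ?(perm_uniq (block_enum_perm S)) ?enum_uniq //.
by move=> /eqP/val_inj.
Qed.

(** A shuffle is determined by the image of its first block, since both blocks are listed in
    increasing order; on sets of size k this is the inverse of [head_set]. *)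
Definition block_perm S : 'S_N := perm (@block_enum_inj S).

Lemma map_block_perm S : map (block_perm S) (enum 'I_N) = block_enum S.
Proof.
have [i0 _|N0] := pickP (@predT 'I_N); last first.
  have e0 : enum 'I_N = [::] by case E: (enum 'I_N) => [//|x e]; have := N0 x.
  by rewrite e0; apply/esym/size0nil; rewrite (perm_size (block_enum_perm S)) e0.
apply: (@eq_from_nth 'I_N i0) => [|i]; rewrite size_map ?size_block_enum size_enum_ord //.
move=> ilt; rewrite (nth_map i0) ?size_enum_ord // permE.
rewrite nth_enum_ord // (set_nth_default i0) ?size_block_enum //.
Qed.

Lemma size_filter_set S : size [seq x <- enum 'I_N | x \in S] = #|S|.
Proof.
have u : uniq [seq x <- enum 'I_N | x \in S] by rewrite filter_uniq ?enum_uniq.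
by rewrite -(card_uniqP u); apply: eq_card => x; rewrite mem_filter mem_enum andbT.
Qed.

Variable k : nat.
Hypothesis kN : (k <= N)%N.

Definition head_set s : {set 'I_N} := [set s i | i : 'I_N & (i < k)%N].

Lemma take_enum : take k (enum 'I_N) = [seq i : 'I_N <- enum 'I_N | (i < k)%N].
Proof.
apply: (irr_sorted_eq ltI_trans ltI_irr); rewrite ?filter_ltI ?take_sorted ?enum_ltI //.
by move=> x; rewrite in_take ?mem_enum // index_enum_ord mem_filter mem_enum andbT.
Qed.

Lemma drop_enum : drop k (enum 'I_N) = [seq i : 'I_N <- enum 'I_N | (k <= i)%N].
Proof.
apply: (irr_sorted_eq ltI_trans ltI_irr); rewrite ?filter_ltI ?drop_sorted ?enum_ltI //.
move=> x; rewrite mem_filter mem_enum andbT leqNgt.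
have := enum_uniq 'I_N; rewrite -{1}(cat_take_drop k (enum 'I_N)) cat_uniq.
case/and3P=> _ /hasPn H _; have := mem_enum 'I_N x.
rewrite -{1}(cat_take_drop k (enum 'I_N)) mem_cat.
have -> : (x < k)%N = (x \in take k (enum 'I_N)).
  by rewrite in_take ?mem_enum // index_enum_ord.
case xt: (x \in take _ _) => //= _; apply/negP=> /H; by rewrite xt.
Qed.

Lemma block_enum_shuffle s : s \in shuffles N k ->
  block_enum (head_set s) = map s (enum 'I_N).
Proof.
move=> /shufflesP sh; rewrite -{1}(cat_take_drop k (enum 'I_N)) map_cat /block_enum.
have mapS (P : pred 'I_N) : (forall i j : 'I_N, P i -> P j -> (i < j)%N -> (s i < s j)%N) ->
    sorted ltI (map s (filter P (enum 'I_N))).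
  move=> H; rewrite sorted_map.
  have sub : {in P &, subrel ltI (relpre s ltI)} by move=> i j iP jP; exact: H.
  exact: (sub_in_sorted sub (filter_all _ _) (filter_ltI P)).
have hs x : (x \in head_set s) = ((s^-1)%g x < k)%N.
  apply/imsetP/idP => [[i ik ->]|H]; first by move: ik; rewrite inE permK.
  by exists ((s^-1)%g x); rewrite ?inE ?permKV.
have mm (P : pred 'I_N) x : (x \in map s (filter P (enum 'I_N))) = P ((s^-1)%g x).
  by rewrite -{1}[x](permKV s) (mem_map perm_inj) mem_filter mem_enum andbT.
congr (_ ++ _); apply: (irr_sorted_eq ltI_trans ltI_irr); rewrite ?filter_ltI //.
- by rewrite take_enum; apply: mapS => i j ik jk ij; apply: sh; rewrite ?jk.
- by move=> x; rewrite take_enum mm mem_filter mem_enum andbT hs.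
- by rewrite drop_enum; apply: mapS => i j ik jk ij; apply: sh; rewrite ?ik ?orbT.
- by move=> x; rewrite drop_enum mm mem_filter mem_enum andbT hs -leqNgt.
Qed.

Lemma block_permK s : s \in shuffles N k -> block_perm (head_set s) = s.
Proof.
move=> /block_enum_shuffle; rewrite -map_block_perm => /eq_in_map E.
by apply/permP=> i; apply: E; rewrite mem_enum.
Qed.

Lemma card_head_set s : #|head_set s| = k.
Proof.
rewrite card_imset; last exact: perm_inj.
transitivity (size (take k (enum 'I_N))).
  have u : uniq [seq x : 'I_N <- enum 'I_N | (x < k)%N] by rewrite filter_uniq ?enum_uniq.
  rewrite take_enum -(card_uniqP u).
  by apply: eq_card => x; rewrite mem_filter mem_enum andbT inE.
by rewrite size_take size_enum_ord; case: ltngtP kN.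
Qed.

Lemma block_perm_mem S i : #|S| = k -> (block_perm S i \in S) = (i < k)%N.
Proof.
move=> Sk; rewrite permE /block_enum nth_cat size_filter_set Sk.
case: ltnP => ik.
  have : nth i [seq x <- enum 'I_N | x \in S] i \in [seq x <- enum 'I_N | x \in S].
    by rewrite mem_nth // size_filter_set Sk.
  by rewrite mem_filter => /andP[].
have : nth i [seq x <- enum 'I_N | x \notin S] (i - k) \in
    [seq x <- enum 'I_N | x \notin S].
  rewrite mem_nth // -(ltn_add2l k) subnKC // -{1}Sk -size_filter_set.
  by rewrite -size_cat size_block_enum.
by rewrite mem_filter => /andP[/negPf].
Qed.

Lemma head_set_block S : #|S| = k -> head_set (block_perm S) = S.
Proof.
move=> Sk; apply/setP=> x; rewrite -[x](permKV (block_perm S)) block_perm_mem //.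
by rewrite mem_imset ?inE //; exact: perm_inj.
Qed.

Lemma block_perm_shuffle S : #|S| = k -> block_perm S \in shuffles N k.
Proof.
move=> Sk; apply/shufflesP => i j ij.
have sz : (k + size [seq x <- enum 'I_N | x \notin S] = N)%N.
  by rewrite -{1}Sk -size_filter_set -size_cat size_block_enum.
rewrite !permE (set_nth_default i j) ?size_block_enum // /block_enum !nth_cat.
rewrite size_filter_set Sk => /orP[jk|ki].
  rewrite (ltn_trans ij jk) jk.
  by apply: (sorted_ltn_nth ltI_trans i (filter_ltI _)); rewrite ?inE ?size_filter_set ?Sk //;
    apply: ltn_trans jk.
rewrite [(i < k)%N]ltnNge ki [(j < k)%N]ltnNge (leq_trans ki (ltnW ij)) /=.
have jN := ltn_ord j.
apply: (sorted_ltn_nth ltI_trans i (filter_ltI _)); last by rewrite ltn_sub2r // (leq_ltn_trans ki).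
  by rewrite unfold_in /= -(ltn_add2l k) sz subnKC // (ltn_trans ij).
by rewrite unfold_in /= -(ltn_add2l k) sz subnKC // (leq_trans ki (ltnW ij)).
Qed.

Lemma sum_shuffles (H : 'S_N -> A) :
  \sum_(s in shuffles N k) H s =
  \sum_(S : {set 'I_N} | #|S| == k) H (block_perm S).
Proof.
rewrite (reindex_onto block_perm head_set) /=; last exact: block_permK.
apply: eq_bigl => S; apply/andP/eqP => [[_ /eqP <-]|Sk]; first exact: card_head_set.
by rewrite head_set_block ?block_perm_shuffle.
Qed.

(** A shuffle is increasing on each block, so an inverted pair has its smaller value in the second
    block and its larger one in the first, that is, outside and inside [S]. *)
Lemma koszul_invs (X : 'I_N -> bool * A) S : #|S| = k ->
  koszul (fun i => (X i).1) (block_perm S) = invs X (enum 'I_N) S.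
Proof.
move=> Sk; have /shufflesP sh := block_perm_shuffle Sk.
rewrite koszulE /invs big_enum exchange_big; apply: eq_bigr => x _.
rewrite big_enum; apply: eq_bigr => y _ /=; congr nat_of_bool.
have mS z : (z \in S) = ((block_perm S)^-1%g z < k)%N.
  by rewrite -{1}[z](permKV (block_perm S)) block_perm_mem.
rewrite !mS; case: ltnP => //= xy.
rewrite [(X y).1 && _]andbC [RHS]andbA -leqNgt; congr (_ && _).
have sxy := permKV (block_perm S).
set i := ((block_perm S)^-1)%g y; set j := ((block_perm S)^-1)%g x.
apply/idP/andP => [ij|[kj ik]]; last exact: leq_trans kj.
have nb : ~~ ((j < k)%N || (k <= i)%N).
  by apply/negP=> b; have := sh i j ij b; rewrite !sxy ltnNge ltnW.
by move: nb; rewrite negb_or -leqNgt -ltnNge => /andP.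
Qed.

End Shuffles.

Lemma shsum_unsh N k (h : {ffun 'I_N -> A} -> A) l : multilinear h ->
  (k <= N)%N -> size l = N -> allhom l ->
  shsum k h (fam N l) =
  unsh (fun a b => if size a == k then h (fam N (a ++ b)) else 0) l.
Proof.
move=> hl kN sl hom; rewrite shsum_fam // sum_shuffles //.
pose X (i : 'I_N) := nth (false, 0 : A) l i.
have El : l = map X (enum 'I_N).
  rewrite /X [RHS](map_comp (fun i => nth (false, 0 : A) l i) val) val_enum_ord.
  by rewrite -sl; exact/esym/mkseq_nth.
rewrite [in RHS]El unsh_sets ?enum_ltI // big_mkcond [RHS]big_mkcond /=.
apply: eq_bigr => S _; rewrite size_map size_filter_set.
have -> : S \subset enum 'I_N by apply/subsetP=> x; rewrite mem_enum.
case: eqP => [Sk|_]; last by rewrite scaler0.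
rewrite (koszul_invs X Sk) -map_cat; congr (_ *: h _).
rewrite -/(block_enum S) -map_block_perm; apply/ffunP=> i; rewrite !ffunE.
rewrite -map_comp (nth_map i) ?size_enum_ord //= nth_ord_enum.
by rewrite /X.
Qed.
End ShuffleSums.

(** * Brackets with the multiplication operators *)

Section Brackets.
Variables (F : fieldType) (A : comSuperAlgType F).
Implicit Types (l a b r s t u : seq (bool * A)).

(* [eq_unsh] with all words over the carrier of the algebra [A]: the sizes obtained
   from [eq_unsh] mention the underlying superspace and are different atoms for [lia]. *)
Lemma eq_unshA (G G' : seq (bool * A) -> seq (bool * A) -> A) l :
  (forall a b, [/\ par a (+) par b = par l, (size a + size b = size l)%N,
    allhom l -> allhom a & allhom l -> allhom b] -> G a b = G' a b) ->
  unsh G l = unsh G' l.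
Proof. exact: eq_unsh. Qed.

Definition vals l : seq A := [seq x.2 | x <- l].

Lemma codom_fam N l : size l = N -> codom (fam N l) = vals l.
Proof.
move=> sl; rewrite codomE.
rewrite (eq_map (g := fun i : 'I_N => nth 0 (vals l) i)); last first.
  by move=> i; rewrite ffunE /vals (nth_map (false, 0)) // sl.
rewrite [LHS](map_comp (nth 0 (vals l)) val) val_enum_ord -sl -(size_map snd l).
exact: mkseq_nth.
Qed.

Lemma homog_sprod l : allhom l -> (0 < size l)%N -> homog (par l) (sprod (vals l)).
Proof.
case: l => //= -[p x] l /andP[/eqP hx hl] _ /=.
elim: l p x hx hl => [|y l IH] p x hx /=; first by rewrite addbF.
move=> /andP[/eqP hy hl]; rewrite addbA; apply: IH => //.
exact: smul_homog.
Qed.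

Lemma sprod_cat (x : A) (s t : seq A) : s != [::] ->
  sprod (x :: s ++ t) = sprod (x :: sprod s :: t).
Proof.
case: s => // y s _ /=; rewrite foldl_cat; congr foldl.
by elim: s y => //= z s IH y; rewrite -smulA IH.
Qed.

Lemma castD_fam n m (e : n = m) (g : Dn A n) l :
  castD e g (fam m.+1 l) = g (fam n.+1 l).
Proof. by case: m / e. Qed.

Lemma DnD n (g h : Dn A n) v : (g + h) v = g v + h v.
Proof. by []. Qed.

Lemma DnN n (g : Dn A n) v : (- g) v = - g v.
Proof. by []. Qed.

Lemma DnZ n c (g : Dn A n) v : (c *: g) v = c *: g v.
Proof. by []. Qed.

Lemma Dn_sum n (I : Type) (r : seq I) (P : pred I) (g : I -> Dn A n) v :
  (\sum_(i <- r | P i) g i) v = \sum_(i <- r | P i) g i v.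
Proof.
apply: (big_morph (fun h : Dn A n => h v)) => //.
Qed.

Section BarwedgeEval.
Variables (n m : nat) (g : Dn A n) (h : Dn A m).

(** The label [q a] is arbitrary because [fam] forgets parities. It has to be the true parity only
    when the outer map is itself expanded by [unsh], as in [weighted_mu]. *)
Lemma barwedge_fam l (q : seq (bool * A) -> bool) :
  size l = (n + m).+1 -> allhom l ->
  barwedge g h (fam (n + m).+1 l) =
  unsh (fun a b => if size a == m.+1 then
    g (fam n.+1 ((q a, h (fam m.+1 a)) :: b)) else 0) l.
Proof.
move=> sl hom; have /is_symmP[gl _] := Dn_symm g; have /is_symmP[hl _] := Dn_symm h.
rewrite /= /barwedge_fun shsum_unsh //; first last.
- by rewrite ltnS leq_addl.
- exact: nest_multilinear.
apply: eq_unshA => a b [_ sab _ _]; case: eqP => // sa; rewrite /nest; congr (g _).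
apply/ffunP=> j; rewrite !ffunE -val_eqE /=.
case: j => -[|j] jn /=.
  congr (h _); apply/ffunP=> i; rewrite !ffunE inordK; last by have := ltn_ord i; lia.
  by rewrite nth_cat sa ltn_ord.
rewrite inordK; last by lia.
by rewrite nth_cat sa ltnNge addnS ltnS leq_addr /= subSS addKn.
Qed.

End BarwedgeEval.

Lemma hpart_fam N q (h : {ffun 'I_N -> A} -> A) l : multilinear h ->
  size l = N -> allhom l -> hpart q h (fam N l) = part (q (+) par l) (h (fam N l)).
Proof.
move=> hl sl hom; pose p0 : {ffun 'I_N -> bool} := [ffun i : 'I_N => (nth (false, 0 : A) l i).1].
have lh i : homog (p0 i) (fam N l i).
  rewrite !ffunE; apply/eqP; apply: (allP hom); apply: mem_nth; by rewrite sl.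
rewrite /hpart (bigD1 p0) //= [X in _ + X]big1 ?addr0 => [|p pq]; last first.
  have [i ip] : exists i, p i != p0 i.
    apply/existsP; rewrite -negb_forall; apply: contraNN pq => /forallP e.
    by apply/eqP/ffunP=> i; apply/eqP.
  rewrite (multilinear0 hl (i := i)) ?linear0 //.
  by rewrite [LHS]ffunE (part_homog_neq (lh i)).
congr (part (_ (+) _) (h _)); last by apply/ffunP=> i; rewrite ffunE; exact: lh.
transitivity (\big[addb/false]_(x <- l) x.1).
  rewrite (big_nth (false, 0)) sl big_mkord; apply: eq_bigr => i _; by rewrite ffunE.
by elim: {sl hom p0 lh} l => [|x l IH]; rewrite ?big_nil // big_cons IH.
Qed.

Lemma mu_fam m l : size l = m.+1 -> mu A m (fam m.+1 l) = sprod (vals l).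
Proof. by move=> sl; rewrite /= /mu_fun codom_fam. Qed.

Lemma Dpart_mu m q : Dpart q (mu A m) = if q then 0 else mu A m.
Proof.
have /is_symmP[ml _] := Dn_symm (mu A m).
apply: Dn_ext_hom => l sl hom.
transitivity (part (q (+) par l) (mu A m (fam m.+1 l))); first exact: hpart_fam.
have hm : homog (par l) (mu_fun (fam m.+1 l)).
  by rewrite -[mu_fun _]/(mu A m _) mu_fam //; apply: homog_sprod; rewrite ?sl.
by case: q; rewrite /= ?hm // (part_homog_neq hm) //; case: (par l).
Qed.

Lemma sum_Dpart n (g : Dn A n) : Dpart false g + Dpart true g = g.
Proof.
have /is_symmP[gl _] := Dn_symm g.
apply: Dn_ext_hom => l sl hom; rewrite DnD /= !hpart_fam //=.
by case: (par l); rewrite /= ?part_sum // addrC part_sum.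
Qed.

(** [mu A m] is even, so the sign of the bracket is 1 and the two parity components of [g] add up to
    [g]. *)
Lemma bracketn_mu m n (g : Dn A n) :
  bracketn (mu A m) g = barwedge (mu A m) g - castD (addnC n m) (barwedge g (mu A m)).
Proof.
rewrite /bracketn; congr (_ - castD _ _).
have E (p : bool) : \sum_(q : bool) (-1 : F) ^+ (p && q) *:
    barwedge (Dpart q g) (Dpart p (mu A m)) = if p then 0 else barwedge g (mu A m).
  rewrite big_bool /= Dpart_mu; case: p => /=.
    by rewrite !barwedge0r !scaler0 addr0.
  rewrite !scale1r; apply: Dn_ext => v; rewrite DnD /= /barwedge_fun /shsum -big_split.
  apply: eq_bigr => p _; rewrite -big_split; apply: eq_bigr => s _ /=.
  rewrite -scalerDr; congr (_ *: _); rewrite /nest -[in RHS](sum_Dpart g) DnD addrC.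
  by [].
by rewrite big_bool !E /= add0r.
Qed.

(** * Weighted sums of the E_(k,l) and their brackets with mu_m *)

Section Weighted.
Variable f : {linear A -> A}.

(* Zero for empty [a], so that sums over all distributions of the letters only
   involve the terms [f (a_1 ... a_k) b_1 ... b_l] with [k >= 1]. *)
Definition fterm a b : A :=
  if a is [::] then 0 else sprod (f (sprod (vals a)) :: vals b).

Definition PhiD n k : Dn A n :=
  MkDn (shsum_symm (@Phi_term_multilinear F A f k n.+1)
    (fun i j ij => @Phi_term_supersym F A f k n.+1 i j ij)).

(* The weight [c] stands for the series [sum_(k, l) c k l x^k/k! y^l/l!]. *)
Definition weighted (c : nat -> nat -> F) n : Dn A n :=
  \sum_(k < n.+1) c k.+1 (n - k)%N *: PhiD n k.+1.

Lemma weighted_fam c n l : size l = n.+1 -> allhom l ->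
  weighted c n (fam n.+1 l) =
  unsh (fun a b => c (size a) (size b) *: fterm a b) l.
Proof.
move=> sl hom; rewrite /weighted Dn_sum.
rewrite (eq_bigr (fun k : 'I_n.+1 => unsh (fun a b =>
  if size a == k.+1 then c (size a) (size b) *: fterm a b else 0) l)); last first.
  move=> k _; rewrite DnZ /= shsum_unsh //; last exact: Phi_term_multilinear.
  rewrite -unshZ; apply: eq_unshA => a b [_ sab _ _].
  case: eqP => [sa|_]; last by rewrite scaler0.
  move: (etrans sab sl); rewrite sa => {}sab.
  rewrite (_ : size b = n - k)%N; last by lia.
  congr (_ *: _); rewrite /Phi_term codom_fam ?size_cat ?sa ?sab //.
  rewrite /vals map_cat take_size_cat ?drop_size_cat ?size_map //.
  by case: a sa {sab}.
rewrite -unsh_sum; apply: eq_unshA => a b [_ sab _ _]; move: (etrans sab sl) => {}sab.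
case: a sab => [|x a] /= sab; first by rewrite big1 ?scaler0.
have an : (size a < n.+1)%N by lia.
rewrite (bigD1 (Ordinal an)) //= eqxx big1 ?addr0 // => i /negPf ia.
by rewrite eqSS eq_sym -[_ == _]/(i == Ordinal an) ia.
Qed.

Lemma fterm_superl b : superL (fun s => fterm s b).
Proof.
move=> s1 s2 x y /and3P[/eqP hx /eqP hy _].
have E z w : fterm (s1 ++ z :: w :: s2) b =
    foldl smul (f (sprod (vals s1 ++ z.2 :: w.2 :: vals s2))) (vals b).
  by rewrite /fterm /vals map_cat; case: s1.
by rewrite !E (sprod_swap _ _ hx hy) linearZ foldl_smulZ.
Qed.

Lemma fterm_superr a : superL (fun s => fterm a s).
Proof.
move=> s1 s2 x y /and3P[/eqP hx /eqP hy _].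
case: a => [|z a]; first by rewrite /= scaler0.
rewrite /fterm /vals !map_cat.
exact: (sprod_swap (f (sprod (vals (z :: a))) :: vals s1) (vals s2) hx hy).
Qed.

(** The m letters multiplied from the right join those already outside f. By coassociativity these
    form one word [r], and [unsh_cat] counts its splittings. *)
Lemma mu_weighted m n c l : size l = (m + n).+1 -> allhom l ->
  barwedge (mu A m) (weighted c n) (fam (m + n).+1 l) =
  unsh (fun a b => 'C(size b, m)%:R * c (size a) (size b - m)%N *: fterm a b) l.
Proof.
move=> sl hom; rewrite (barwedge_fam _ _ (fun=> false)) //.
transitivity (unsh (fun s b => unsh (fun t u => if (size t + size u == n.+1)%N then
    c (size t) (size u) *: fterm t (u ++ b) else 0) s) l).
  apply: eq_unshA => s b [_ sab hs _]; move: (etrans sab sl) => {}sab.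
  case: eqP => [ss|ns]; last first.
    rewrite (eq_unshA (G' := fun _ _ => 0)) ?unsh0 // => x y [_ sxy _ _].
    by rewrite sxy; case: eqP.
  rewrite mu_fam /=; last by lia.
  rewrite weighted_fam ?hs // (linear_unsh (f := fun z => foldl smul z (vals b))); last first.
    by move=> *; exact: foldl_smul_linear.
  apply: eq_unshA => x y [_ sxy _ _]; rewrite sxy ss eqxx foldl_smulZ; congr (_ *: _).
  rewrite /fterm; case: x {sxy} => [|z x]; last by rewrite /vals map_cat /= foldl_cat.
  by have := foldl_smulZ (vals b) 0 0; rewrite !scale0r => ->.
rewrite unsh_coassoc; apply: eq_unshA => x r [_ sxr _ hr]; move: (etrans sxr sl) => {}sxr.
have [rm|mr] := ltnP (size r) m.
  rewrite bin_small // mul0r scale0r.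
  rewrite (eq_unshA (G' := fun _ _ => 0)) ?unsh0 // => y b [_ syb _ _].
  by case: eqP => // e; exfalso; lia.
rewrite -(bin_sub mr) mulrC -scalerA -(unsh_cat _ (@fterm_superr x) (hr hom)) -unshZ.
apply: eq_unshA => y b [_ syb _ _].
have -> : (size x + size y == n.+1)%N = (size y == size r - m)%N by lia.
by case: eqP => [->|]; rewrite ?scaler0.
Qed.

(** The product of the m+1 letters of [u] enters either f or the outer word. In the second case it
    passes [a], and cocommutativity absorbs the resulting sign. *)
Lemma weighted_mu m n c l : size l = (n + m).+1 -> allhom l ->
  barwedge (weighted c n) (mu A m) (fam (n + m).+1 l) =
  unsh (fun a b => ('C(size a, m.+1)%:R * c (size a - m)%N (size b) +
    'C(size b, m.+1)%:R * c (size a) (size b - m)%N) *: fterm a b) l.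
Proof.
move=> sl hom; rewrite (barwedge_fam _ _ (fun s => par s)) //.
transitivity (unsh (fun u r => unsh (fun a b => if size u == m.+1 then
    c (size a).+1 (size b) *: fterm (u ++ a) b else 0) r) l +
  unsh (fun u r => unsh (fun a b => (-1) ^+ (par u && par a) *: (if size u == m.+1 then
    c (size a) (size b).+1 *: fterm a (u ++ b) else 0)) r) l).
  rewrite -unshD; apply: eq_unshA => u r [_ sur hu hr]; move: (etrans sur sl) => {}sur.
  case: eqP => [su|nu]; last first.
    rewrite unsh0 add0r (eq_unshA (G' := fun _ _ => 0)) ?unsh0 // => a b _.
    by rewrite scaler0.
  have hm : homog (par u) (mu A m (fam m.+1 u)).
    by rewrite mu_fam //; apply: homog_sprod; rewrite ?su ?hu.
  have hX : allhom ((par u, mu A m (fam m.+1 u)) :: r).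
    by apply/andP; split; [exact/eqP/hm | exact: hr].
  rewrite weighted_fam // ?mu_fam //; last by rewrite /=; lia.
  case: u su {sur hu hm hX} => [//|z u] su.
  congr (_ + _); apply: eq_unshA => a b _; congr (_ *: _).
    by rewrite /fterm /vals map_cat /= foldl_cat.
  congr (_ *: _); case: a => // w a; rewrite /fterm /vals map_cat.
  by rewrite sprod_cat.
rewrite -!unsh_coassoc.
under [X in _ + X]eq_unshA => s b _ do
  rewrite (unsh_cocomm (fun a u => if size u == m.+1 then
    c (size a) (size b).+1 *: fterm a (u ++ b) else 0)).
rewrite [X in _ + X]unsh_coassoc -unshD; apply: eq_unshA => s b [_ ssb hs hb].
rewrite scalerDl; congr (_ + _).
  rewrite mulrC -scalerA -(unsh_cat _ (@fterm_superl b) (hs hom)) -unshZ.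
  apply: eq_unshA => u a [_ sua _ _].
  case: eqP => [su|]; rewrite ?scaler0 //; congr (c _ _ *: _); lia.
rewrite mulrC -scalerA -(unsh_cat _ (@fterm_superr s) (hb hom)) -unshZ.
apply: eq_unshA => u a [_ sua _ _].
by case: eqP => [su|]; rewrite ?scaler0 //; congr (c _ _ *: _); lia.
Qed.

(* The operator [y^m/m! - y^(m+1)/(m+1)! d/dy - x^(m+1)/(m+1)! d/dx] on the series
   of the weights. *)
Definition wrho (m : nat) (c : nat -> nat -> F) (k l : nat) : F :=
  ('C(l, m)%:R - 'C(l, m.+1)%:R) * c k (l - m)%N - 'C(k, m.+1)%:R * c (k - m)%N l.

Lemma rho_weighted m c : rho m (weighted c) = weighted (wrho m c).
Proof.
apply: functional_extensionality_dep => n; rewrite /rho /bracket.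
have [mn|nm] := leqP m n; last first.
  rewrite big1 => [|i _]; last first.
    rewrite inD_neq ?bracketn0l ?castD0 //; have := ltn_ord i; lia.
  rewrite /weighted big1 // => k _; have kn := ltn_ord k.
  rewrite /wrho !bin_small; try lia.
  by rewrite subrr !mul0r subr0 scale0r.
have mn' : (m < n.+1)%N by rewrite ltnS.
rewrite (bigD1 (Ordinal mn')) //= big1 ?addr0 => [|i im]; last first.
  by rewrite inD_neq ?bracketn0l ?castD0 // eq_sym.
rewrite inD_eq bracketn_mu; apply: Dn_ext_hom => l sl hom.
rewrite castD_fam DnD DnN castD_fam.
rewrite mu_weighted ?weighted_mu ?weighted_fam // ?(subnK mn) ?(subnKC mn) //.
rewrite -[X in _ + X]scaleN1r -unshZ -unshD; apply: eq_unshA => a b _.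
by rewrite scaleN1r -scaleNr -scalerDl /wrho; congr (_ *: _); ring.
Qed.

(** The series of this weight is e^x e^(-y). As [weighted] reads only first indices k >= 1, it
    stands equally for (e^x - 1) e^(-y). *)
Lemma PhiD_weighted n : Phi f n = weighted (fun _ j => (-1) ^+ j) n.
Proof.
apply: Dn_ext => v; rewrite /weighted Dn_sum /= /Phi_fun.
by rewrite big_add1 big_mkord; apply: eq_bigr => k _; rewrite subSS.
Qed.

Lemma opD_weighted : inD (opD f) = weighted (fun k j => ((k == 1%N) && (j == 0%N))%:R).
Proof.
apply: functional_extensionality_dep => n.
case: n => [|n].
  rewrite inD_eq; apply: Dn_ext_hom => l sl hom; rewrite weighted_fam //.
  case: l sl hom => [|x [|y l]] //= _ _.
  by rewrite /fterm /= !scale1r scale0r !scaler0 addr0 ffunE.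
rewrite inD_neq // /weighted big1 // => k _.
case: (k =P ord0) => [->|/eqP]; first by rewrite andbF scale0r.
by rewrite -val_eqE /= eqSS => /negPf ->; rewrite scale0r.
Qed.

End Weighted.
End Brackets.

(** * Exponentials of differential operators *)

(** Stated for a general pairing [B], to cover both products of polynomials and the weights
    [tens a b]. *)
Lemma iter_leibniz (U1 U2 : Type) (U3 : zmodType) (B : U1 -> U2 -> U3)
    (D1 : U1 -> U1) (D2 : U2 -> U2) (D3 : U3 -> U3) :
  {morph D3 : x y / x + y} ->
  (forall a b, D3 (B a b) = B (D1 a) b + B a (D2 b)) ->
  forall n a b, iter n D3 (B a b) =
    \sum_(i < n.+1) B (iter i D1 a) (iter (n - i) D2 b) *+ 'C(n, i).
Proof.
move=> addD3 leib; elim=> [|n IH] a b; first by rewrite big_ord1.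
have addI x y : iter n D3 (x + y) = iter n D3 x + iter n D3 y.
  by elim: n {IH} => //= n ->.
rewrite iterSr leib addI !IH [in RHS]big_ord_recl /= bin0 addrC.
rewrite [X in X + _]big_ord_recl /= bin0 subn0 !mulr1n -!iterSr -addrA; congr (_ + _).
rewrite [in RHS](eq_bigr (fun i : 'I_n.+1 =>
    B (iter i.+1 D1 a) (iter (n - i) D2 b) *+ 'C(n, i.+1) +
    B (iter i.+1 D1 a) (iter (n - i) D2 b) *+ 'C(n, i))); last first.
  by move=> i _; rewrite /bump /= add1n subSS binS mulrnDr.
rewrite big_split /=; congr (_ + _); last first.
  by apply: eq_bigr => i _; rewrite -iterSr.
rewrite [RHS]big_ord_recr /= bin_small // mulr0n addr0; apply: eq_bigr => i _.
by rewrite /bump /= add1n -iterSr -subSn.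
Qed.

(** The Cauchy product of two exponentials: the vanishing hypothesis lets the triangle i + j < N be
    completed to a square. *)
Lemma exp_conv (R : numFieldType) N (t : nat -> nat -> R) :
  (forall i j, (N <= i + j)%N -> t i j = 0) ->
  \sum_(n < N) (n`!%:R)^-1 * \sum_(i < n.+1) t i (n - i)%N *+ 'C(n, i) =
  \sum_(i < N) \sum_(j < N) (i`!%:R)^-1 * (j`!%:R)^-1 * t i j.
Proof.
move=> t0; pose G i j := (i`!%:R)^-1 * (j`!%:R)^-1 * t i j.
have fact_neq0 n : n`!%:R != 0 :> R by rewrite Num.Theory.pnatr_eq0 -lt0n fact_gt0.
transitivity (\sum_(n < N) \sum_(i < n.+1) G i (n - i)%N).
  apply: eq_bigr => n _; rewrite mulr_sumr; apply: eq_bigr => i _.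
  have le : (i <= n)%N by rewrite -ltnS.
  rewrite /G -mulr_natr -(bin_fact le) !natrM; field.
  by rewrite !fact_neq0 Num.Theory.pnatr_eq0 -lt0n bin_gt0 le.
transitivity (\sum_(i < N) \sum_(j < N - i) G i j).
  elim: N {t0} => [|N IH]; first by rewrite !big_ord0.
  rewrite big_ord_recr IH /= [in RHS]big_ord_recr /= subSn // subnn big_ord1.
  rewrite [in LHS]big_ord_recr /= subnn addrA; congr (_ + _).
  rewrite -big_split; apply: eq_bigr => i _ /=.
  by rewrite subSn 1?ltnW // big_ord_recr.
apply: eq_bigr => i _.
rewrite (big_ord_widen N (G i)) ?leq_subr // big_mkcond; apply: eq_bigr => j _.
by case: ltnP => //; rewrite leq_subLR /G => /t0 ->; rewrite mulr0.
Qed.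

(** * First-order differential operators modulo a power of X *)

Section Truncated.
Variable R : numFieldType.
Implicit Types (p q r : {poly R}) (M : nat).

Definition eqm M p q := 'X^M %| p - q.

Lemma dvdXnP M p : reflect (forall i, (i < M)%N -> p`_i = 0) ('X^M %| p).
Proof.
apply: (iffP idP) => [/dvdpP[q ->] i iM|H]; first by rewrite coefMXn iM.
rewrite -(poly_take_drop M p) dvdp_addl ?dvdp_mulIr //.
suff -> : take_poly M p = 0 by rewrite dvdp0.
by apply/polyP=> i; rewrite coef_take_poly coef0; case: ltnP => // /H.
Qed.

Lemma eqmP M p q : reflect (forall i, (i < M)%N -> p`_i = q`_i) (eqm M p q).
Proof.
apply: (iffP (dvdXnP M _)) => H i iM; last by rewrite coefB H // subrr.
by have := H i iM; rewrite coefB => /eqP; rewrite subr_eq0 => /eqP.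
Qed.

Lemma eqmE M p q : eqm M p q -> forall i, (i < M)%N -> p`_i = q`_i.
Proof. by move/eqmP. Qed.

Lemma eqm_refl M p : eqm M p p.
Proof. by rewrite /eqm subrr dvdp0. Qed.

Lemma eqm_sym M p q : eqm M p q -> eqm M q p.
Proof. by move/eqmP=> H; apply/eqmP=> i /H. Qed.

Lemma eqm_trans M p q r : eqm M p q -> eqm M q r -> eqm M p r.
Proof. by move=> /eqmP H /eqmP H'; apply/eqmP=> i iM; rewrite H ?H'. Qed.

Lemma eqm_leq M M' p q : (M <= M')%N -> eqm M' p q -> eqm M p q.
Proof. by move=> le /eqmP H; apply/eqmP=> i iM; apply: H; apply: leq_trans le. Qed.

Lemma eqmM M p p' q q' : eqm M p p' -> eqm M q q' -> eqm M (p * q) (p' * q').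
Proof.
move=> pp qq; rewrite /eqm (_ : _ - _ = (p - p') * q + p' * (q - q')); last by ring.
by apply: dvdp_add; [apply: dvdp_mulr | apply: dvdp_mull].
Qed.

Lemma eqmX M p q n : eqm M p q -> eqm M (p ^+ n) (q ^+ n).
Proof.
move=> pq; elim: n => [|n IH]; first exact: eqm_refl.
by rewrite !exprS; apply: eqmM.
Qed.

Lemma eqmD M p p' q q' : eqm M p p' -> eqm M q q' -> eqm M (p + q) (p' + q').
Proof.
by move=> /eqmP H /eqmP H'; apply/eqmP=> i iM; rewrite !coefD H ?H'.
Qed.

Lemma eqmZ M c p q : eqm M p q -> eqm M (c *: p) (c *: q).
Proof. by move=> /eqmP H; apply/eqmP=> i iM; rewrite !coefZ H. Qed.

Lemma eqm_sum M (I : Type) (s : seq I) (P : pred I) (G H : I -> {poly R}) :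
  (forall i, P i -> eqm M (G i) (H i)) ->
  eqm M (\sum_(i <- s | P i) G i) (\sum_(i <- s | P i) H i).
Proof.
move=> E; apply: (big_ind2 (eqm M)) => //; first exact: eqm_refl.
by move=> *; apply: eqmD.
Qed.

Lemma eqm_comp M p q r : eqm M q r -> eqm M (p \Po q) (p \Po r).
Proof.
move=> qr; rewrite !comp_polyE; apply: eqm_sum => i _.
exact/eqmZ/eqmX.
Qed.

Lemma eqm_deriv M p q : eqm M.+1 p q -> eqm M p^`() q^`().
Proof. by move=> /eqmP H; apply/eqmP=> i iM; rewrite !coef_deriv H. Qed.

Lemma eqm_integ M p q : p`_0 = q`_0 -> eqm M p^`() q^`() -> eqm M.+1 p q.
Proof.
move=> e0 /eqmP H; apply/eqmP=> -[//|i] iM; have := H i iM.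
rewrite !coef_deriv -mulr_natr -[in RHS]mulr_natr => /mulIf; apply.
by rewrite Num.Theory.pnatr_eq0.
Qed.

(** The common form of V (with w = 0) and W (with w = v'). *)
Definition diffop v w p := v * p^`() - w * p.

Lemma diffopD v w : {morph diffop v w : p q / p + q}.
Proof. by move=> p q; rewrite /diffop derivD; ring. Qed.

Lemma diffopZ v w c p : diffop v w (c *: p) = c *: diffop v w p.
Proof. by rewrite /diffop derivZ -!mul_polyC; ring. Qed.

Lemma diffop_leibniz v w w' p q :
  diffop v (w + w') (p * q) = diffop v w p * q + p * diffop v w' q.
Proof. by rewrite /diffop derivM; ring. Qed.

Variables (v w : {poly R}).
Hypotheses (v2 : 'X^2 %| v) (w1 : 'X^1 %| w).

Lemma diffop_dvd M p : 'X^M %| p -> 'X^(M.+1) %| diffop v w p.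
Proof.
move=> /dvdpP[q ->].
have [v' ->] : exists v', v = v' * 'X^2 by apply/dvdpP.
have [w' ->] : exists w', w = w' * 'X^1 by apply/dvdpP.
apply/dvdpP; case: M => [|M].
  by exists (v' * q^`() * 'X - w' * q); rewrite /diffop mulr1; ring.
exists (v' * (q^`() * 'X + q *+ M.+1) - w' * q).
rewrite /diffop derivM derivXn /= !exprS; ring.
Qed.

Lemma iter_diffop_dvd n M p : 'X^M %| p -> 'X^(n + M) %| iter n (diffop v w) p.
Proof. by move=> pM; elim: n => //= n IH; apply: diffop_dvd. Qed.

(** When X^2 divides v and X divides w, the terms of index n >= N have order at least N, so the cut
    is exact modulo X^N. *)
Definition expop N p := \sum_(n < N) (n`!%:R)^-1 *: iter n (diffop v w) p.

Lemma coef_expop N p i :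
  (expop N p)`_i = \sum_(n < N) (n`!%:R)^-1 * (iter n (diffop v w) p)`_i.
Proof. by rewrite coef_sum; apply: eq_bigr => n _; rewrite coefZ. Qed.

Lemma iter_diffopZ n c p :
  iter n (diffop v w) (c *: p) = c *: iter n (diffop v w) p.
Proof. by elim: n => //= n ->; rewrite diffopZ. Qed.

Lemma iter_diffopD n : {morph iter n (diffop v w) : p q / p + q}.
Proof. by move=> p q; elim: n => //= n ->; rewrite diffopD. Qed.

Lemma expopD N : {morph expop N : p q / p + q}.
Proof.
move=> p q; rewrite /expop -big_split; apply: eq_bigr => n _ /=.
by rewrite iter_diffopD scalerDr.
Qed.

Lemma expopZ N c p : expop N (c *: p) = c *: expop N p.
Proof.
rewrite /expop scaler_sumr; apply: eq_bigr => n _ /=.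
by rewrite iter_diffopZ !scalerA mulrC.
Qed.

Lemma diffop_expop N p : diffop v w (expop N p) = expop N (diffop v w p).
Proof.
rewrite /expop (big_morph _ (diffopD v w) (_ : diffop v w 0 = 0)); last first.
  by rewrite /diffop deriv0 !mulr0 subrr.
by apply: eq_bigr => n _; rewrite diffopZ -iterS iterSr.
Qed.

End Truncated.

Lemma expopM (R : numFieldType) (v w w' p q : {poly R}) M :
  'X^2 %| v -> 'X^1 %| w -> 'X^1 %| w' ->
  eqm M (expop v (w + w') M (p * q)) (expop v w M p * expop v w' M q).
Proof.
move=> v2 w1 w1'; apply/eqmP=> c cM.
pose t i j := (iter i (diffop v w) p * iter j (diffop v w') q)`_c.
rewrite coef_expop mulr_suml coef_sum.
under [RHS]eq_bigr => i _ do rewrite mulr_sumr coef_sum.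
transitivity (\sum_(n < M) (n`!%:R)^-1 * \sum_(i < n.+1) t i (n - i)%N *+ 'C(n, i)).
  apply: eq_bigr => n _; congr (_ * _).
  rewrite (iter_leibniz (diffopD v (w + w')) (diffop_leibniz v w w')) coef_sum.
  by apply: eq_bigr => i _; rewrite coefMn.
rewrite exp_conv => [|i j ij].
  by apply: eq_bigr => i _; apply: eq_bigr => j _;
    rewrite -scalerAl -scalerAr !coefZ mulrA.
have d u n r : 'X^1 %| u -> 'X^n %| iter n (diffop v u) r.
  by move=> u1; rewrite -[X in 'X^X]addn0 iter_diffop_dvd // expr0 dvd1p.
have /dvdXnP : 'X^(i + j) %| iter i (diffop v w) p * iter j (diffop v w') q.
  by rewrite exprD dvdp_mul ?d.
by apply; apply: leq_trans ij.
Qed.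

(** * The truncated exponential and uniqueness for the Julia equation *)

Section Julia.
Variable R : numFieldType.
Implicit Types (p q r : {poly R}) (M : nat).

Definition texp M : {poly R} := \poly_(i < M) (i`!%:R)^-1.

Lemma fact_unit n : n`!%:R != 0 :> R.
Proof. by rewrite Num.Theory.pnatr_eq0 -lt0n fact_gt0. Qed.

Lemma coef_texpX M j n : (n < M)%N -> (texp M ^+ j)`_n = j%:R ^+ n / n`!%:R.
Proof.
elim: j n => [|j IH] n nM.
  rewrite expr0 coef1 expr0n; case: n {nM} => [|n] /=; by rewrite ?mul0r ?divr1.
rewrite exprSr coefM -[j.+1]addn1 natrD addrC exprDn mulr_suml; apply: eq_bigr => i _.
have le : (i <= n)%N by rewrite -ltnS.
rewrite IH ?(leq_ltn_trans le) // coef_poly (leq_ltn_trans (leq_subr _ _)) //.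
rewrite expr1n mul1r -mulr_natr -(bin_fact le) !natrM; field.
by rewrite !fact_unit Num.Theory.pnatr_eq0 -lt0n bin_gt0 le.
Qed.

Lemma texpN M : eqm M (texp M * \poly_(i < M) ((-1) ^+ i / i`!%:R)) 1.
Proof.
apply/eqmP=> n nM; rewrite mulrC coefM coef1.
transitivity ((1 - 1 : R) ^+ n / n`!%:R); last first.
  by rewrite subrr expr0n; case: n {nM} => [|n]; rewrite ?mul0r ?divr1.
rewrite exprDn mulr_suml; apply: eq_bigr => i _.
have le : (i <= n)%N by rewrite -ltnS.
rewrite !coef_poly (leq_ltn_trans le nM) (leq_ltn_trans (leq_subr _ _) nM) expr1n mul1r.
rewrite -[_ *+ 'C(n, i)]mulr_natr -(bin_fact le) !natrM; field.
by rewrite !fact_unit Num.Theory.pnatr_eq0 -lt0n bin_gt0 le.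
Qed.

Lemma texp_deriv M : eqm M (texp M.+1)^`() (texp M.+1).
Proof.
apply/eqmP=> i iM; rewrite coef_deriv !coef_poly ltnS iM (ltn_trans iM) //.
rewrite -[_ *+ _]mulr_natr factS natrM; field.
by rewrite fact_unit /= ?natr1 ?nat1r Num.Theory.pnatr_eq0.
Qed.

(* The Julia equation determines its solution [p = X + X^2/2 + ...]. *)
Lemma julia_unique M v p q : eqm 3 v (2%:R^-1 *: 'X^2) ->
  eqm 3 p ('X + 2%:R^-1 *: 'X^2) -> eqm 3 q ('X + 2%:R^-1 *: 'X^2) ->
  eqm M.+1 (v \Po p) (v * p^`()) -> eqm M.+1 (v \Po q) (v * q^`()) -> eqm M p q.
Proof.
move=> v3 p3 q3 Jp Jq.
suff H c : (c <= M)%N -> eqm c p q by exact: H.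
have [r vE] : exists r, v = 2%:R^-1 *: 'X^2 + r * 'X^3.
  by case/dvdpP: v3 => r /(canRL (subrK _)) ->; exists r; rewrite addrC.
elim: c => [_|c IH cM]; first by apply/eqmP.
have [c3|c3] := ltnP c 3.
  exact: (eqm_leq c3 (eqm_trans p3 (eqm_sym q3))).
have {}IH := IH (ltnW cM).
have /dvdpP[d /(canRL (subrK _)) pE] := IH.
have expand (t : {poly R}) : eqm 3 t ('X + 2%:R^-1 *: 'X^2) -> exists t', t = 'X + t' * 'X^2.
  case/dvdpP=> t' /(canRL (subrK _)) ->; exists (t' * 'X + 2%:R^-1%:P).
  by rewrite -mul_polyC; ring.
have [a pa] := expand _ p3; have [b qb] := expand _ q3.
have /(eqm_comp r)/dvdpP[s /(canRL (subrK _)) rE] := IH.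
have Jd : 'X^(c.+2) %| (v \Po p - v * p^`()) - (v \Po q - v * q^`()).
  by apply: dvdp_sub; [apply: eqm_leq Jp | apply: eqm_leq Jq].
(* To first order in d, v(p) - v(q) is d X^(c+1), while v (p' - q') is (c/2) d X^(c+1). The factor
   (2 - c)/2 vanishes at c = 2, which is why the quadratic coefficient is prescribed. *)
have {}Jd : 'X^(c.+2) %| 2%:R^-1 * (2%:R - c%:R) *: (d * 'X^(c.+1)).
  case: c c3 cM pE IH rE Jd => [|[|[|c]]] // _ _ pE _ rE /dvdpP[z zE].
  have vC (t : {poly R}) : v \Po t = 2%:R^-1%:P * t ^+ 2 + (r \Po t) * t ^+ 3.
    by rewrite vE comp_polyD comp_polyZ comp_Xn_poly comp_polyM comp_Xn_poly -mul_polyC.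
  move: zE; rewrite !vC rE pE vE derivD derivM derivXn /= -!mul_polyC qb.
  rewrite polyCM polyCB !polyC_natr.
  move: (r \Po _) (2%:R^-1%:P) => rq H zE; apply/dvdpP.
  (* The cofactor of all higher-order terms, expanded with q = X + b X^2, p = q + d X^(c+3) and r(p)
     = r(q) + s X^(c+3); [H] stands for 1/2 and [rq] for r(q). *)
  exists (z - (H * d ^+ 2 * 'X * 'X^c + 2%:R * H * d * b +
    s * 'X * (d * 'X ^+ 2 * 'X^c + 1 + b * 'X) ^+ 3 +
    rq * d * (d ^+ 2 * 'X ^+ 4 * 'X^c ^+ 2 + 3%:R * d * 'X ^+ 2 * 'X^c * (1 + b * 'X) +
    3%:R * (1 + b * 'X) ^+ 2) - H * d^`() - r * (d^`() * 'X + d * c.+3%:R))).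
  rewrite mulrBl -zE -[_ *+ c.+3]mulr_natr !exprS; ring.
have d0 : d`_0 = 0.
  have /dvdXnP/(_ c.+1 (leqnn _)) := Jd.
  rewrite coefZ coefMXn ltnn subnn => /eqP; rewrite !mulf_eq0 invr_eq0 subr_eq0.
  rewrite Num.Theory.pnatr_eq0 Num.Theory.eqr_nat /=.
  by case: c c3 {IH cM pE rE Jd} => [|[|[|c]]] //= _ /eqP.
have /dvdXnP/dvdpP[d' d'E] : forall i, (i < 1)%N -> d`_i = 0 by case.
by rewrite /eqm pE addrK d'E -mulrA -exprD dvdp_mull // add1n.
Qed.

End Julia.

(** * The Julia equation for the numbers K_n *)

Section KoszulNumbers.
Variable K : nat -> rat.
Hypotheses (K1 : K 1%N = 1)
  (KS : forall n : nat, (2 <= n)%N ->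
     K n = - 2%:R / ((n%:R + 2%:R) * (n%:R - 1)) *
           \sum_(1 <= i < n) stirling2 n.+1 i * K i).

Definition coefv i : rat := if (i < 2)%N then 0 else K i.-1.

(* The truncation of [v = sum_n K_n x^(n+1)/(n+1)!]. *)
Definition vpoly M : {poly rat} := \poly_(i < M.+1) (coefv i / i`!%:R).

Lemma coef_vpoly M i : (i < M.+1)%N -> (vpoly M)`_i = coefv i / i`!%:R.
Proof. by rewrite coef_poly => ->. Qed.

Lemma coef_dvpoly M i : (i < M)%N ->
  (vpoly M)^`()`_i = (if i == 0%N then 0 else K i) / i`!%:R.
Proof.
move=> iM; rewrite coef_deriv coef_vpoly // -mulr_natr /coefv factS natrM.
case: i {iM} => [|i] /=; first by rewrite !mul0r.
by field; rewrite fact_unit -natrD Num.Theory.pnatr_eq0.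
Qed.

(** The exponential generating function of the Stirling numbers; the defining alternating sum is the
    binomial expansion of (e^x - 1)^i. *)
Lemma texp1_coef M n i : (n < M)%N ->
  ((texp rat M - 1) ^+ i)`_n = stirling2 n i * i`!%:R / n`!%:R.
Proof.
move=> nM; rewrite /stirling2 [_^-1 * _]mulrC divfK ?fact_unit //.
rewrite exprBn coef_sum mulr_suml [RHS](reindex_inj rev_ord_inj); apply: eq_bigr => j _ /=.
have ji : (j <= i)%N by rewrite -ltnS.
rewrite subSS subKn // bin_sub // expr1n mulr1 coefMn.
rewrite -[_ *+ 'C(i, j)]mulr_natr -[in LHS]signr_odd -[in RHS]signr_odd.
by case: (odd j); rewrite /= ?expr1 ?mulN1r ?coefN ?expr0 ?mul1r coef_texpX //; ring.
Qed.

(* [texp - 1 = 'X * u] with [u = 1 + 'X / 2 + ...] gives the extreme coefficients. *)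
Lemma texp1_lead M : (2 < M)%N -> exists2 u, texp rat M - 1 = 'X * u &
  u`_0 = 1 /\ u`_1 = 2%:R^-1.
Proof.
move=> M2; have /dvdXnP/dvdpP[u uE] : forall i, (i < 1)%N -> (texp rat M - 1)`_i = 0.
  by case=> // _; rewrite coefB coef_poly coef1 (ltn_trans _ M2) //= invr1 subrr.
exists u; first by rewrite uE mulrC.
have E i : (i.+1 < M)%N -> u`_i = (i.+1`!%:R)^-1.
  move=> iM; have := coefMXn 1 u i.+1; rewrite -uE coefB coef_poly iM coef1 subr0 /=.
  by rewrite subn1.
by rewrite !E // ltnW.
Qed.

Lemma coefX_lead (u : {poly rat}) n : u`_0 = 1 ->
  (u ^+ n)`_0 = 1 /\ (u ^+ n)`_1 = n%:R * u`_1.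
Proof.
move=> u0; elim: n => [|n [IH0 IH1]]; first by rewrite expr0 !coef1 mul0r.
rewrite exprS !coefM !big_ord_recl !big_ord0 /= !subn0 ?u0 ?IH0 ?IH1.
by split; [ring | rewrite -nat1r /bump /=; ring].
Qed.

Lemma stirling2_texp n i : stirling2 n i =
  ((texp rat n.+3 - 1) ^+ i)`_n * n`!%:R / i`!%:R.
Proof. rewrite texp1_coef; last by lia.
by rewrite divfK ?fact_unit // mulfK ?fact_unit. Qed.

Lemma stirling2_diag n : stirling2 n n = 1.
Proof.
rewrite stirling2_texp; have [|u -> [u0 _]] := @texp1_lead n.+3 => //.
rewrite exprMn coefXnM ltnn subnn (coefX_lead n u0).1 mul1r.
by rewrite divff ?fact_unit.
Qed.

Lemma stirling2_subdiag n : stirling2 n.+1 n = n%:R * n.+1%:R / 2%:R.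
Proof.
rewrite stirling2_texp; have [|u -> [u0 u1]] := @texp1_lead n.+4 => //.
rewrite exprMn coefXnM ltnNge leqnSn subSnn (coefX_lead n u0).2 u1.
by rewrite /= factS natrM; field; rewrite fact_unit.
Qed.

(** The recursion makes the sum up to n - 1 equal to -(n+2)(n-1)/2 K_n, and the last term adds
    n(n+1)/2 K_n; the two coefficients sum to 1. In this form the case n = 1 holds too. *)
Lemma stirling2_sumK n : (0 < n)%N -> \sum_(1 <= i < n.+1) stirling2 n.+1 i * K i = K n.
Proof.
case: n => // -[|n] _.
  by rewrite big_nat1 stirling2_subdiag K1 mulr1; field.
rewrite big_nat_recr //= stirling2_subdiag [in RHS]KS //.
set S := \sum_(_ <= _ < _) _; rewrite KS // -/S.
have n1 : n.+2%:R - 1 != 0 :> rat by rewrite subr_eq0 (Num.Theory.eqr_nat _ n.+2 1).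
have n2 : n.+2%:R + 2%:R != 0 :> rat by rewrite -natrD Num.Theory.pnatr_eq0.
rewrite -[n.+3%:R]natr1; move: (n.+2%:R : rat) n1 n2 => x n1 n2.
by field; rewrite n1 n2.
Qed.

Lemma coef_comp_small (p q : {poly rat}) n : q`_0 = 0 ->
  (p \Po q)`_n = \sum_(i < n.+1) p`_i * (q ^+ i)`_n.
Proof.
move=> q0; have big m : (n < m)%N -> (size p <= m)%N ->
    (p \Po q)`_n = \sum_(i < m) p`_i * (q ^+ i)`_n /\
    \sum_(i < n.+1) p`_i * (q ^+ i)`_n = \sum_(i < m) p`_i * (q ^+ i)`_n.
  move=> nm pm; rewrite coef_comp_poly.
  rewrite (big_ord_widen m (fun i => p`_i * (q ^+ i)`_n) nm).
  rewrite (big_ord_widen m (fun i => p`_i * (q ^+ i)`_n) pm).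
  split; rewrite big_mkcond; apply: eq_bigr => i _; case: ltnP => // le.
    by rewrite nth_default ?mul0r.
  have /dvdXnP/dvdpP[u ->] : forall j, (j < 1)%N -> q`_j = 0 by case.
  by rewrite exprMn -exprM mul1n coefMXn le mulr0.
by have [||-> ->] := big (maxn n.+1 (size p)); rewrite ?leq_maxl ?leq_maxr.
Qed.

(** Both sides vanish at 0. After differentiating and dividing by e^x, the claim is v'(e^x - 1) = v
    + v' ([D]), whose coefficients say that the sum of S(n,i) K_i over 1 <= i <= n is K_(n-1) + K_n
    for n >= 2. *)
Lemma vpoly_julia M :
  eqm M.+1 (vpoly M.+1 \Po (texp rat M.+1 - 1)) (texp rat M.+1 * vpoly M.+1).
Proof.
set phi := _ - 1; set v := vpoly _.
have phi0 : phi`_0 = 0 by rewrite coefB coef_poly coef1 /= invr1 subrr.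
have v0 : v`_0 = 0 by rewrite coef_vpoly // mul0r.
have D : eqm M.+1 (v^`() \Po phi) (v + v^`()).
  apply/eqmP=> n nM; rewrite coefD coef_vpoly ?ltnS 1?ltnW // coef_dvpoly //.
  rewrite coef_comp_small // big_ord_recl coef_dvpoly //= !mul0r add0r.
  transitivity (\sum_(i < n) stirling2 n i.+1 * K i.+1 / n`!%:R).
    apply: eq_bigr => i _; rewrite coef_dvpoly; last by have := ltn_ord i; rewrite /bump; lia.
    rewrite texp1_coef // /bump /=; field; by rewrite !fact_unit.
  rewrite -mulr_suml -mulrDl; congr (_ / _).
  case: n nM => [|[|m]] _; first by rewrite big_ord0 /coefv addr0.
    by rewrite big_ord1 stirling2_diag mul1r /coefv add0r.
  rewrite big_ord_recr /= stirling2_diag mul1r; congr (_ + _).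
  by rewrite /coefv /= -(@stirling2_sumK m.+1) // big_add1 big_mkord.
apply: eqm_integ.
  rewrite coef_comp_small // big_ord1 v0 mul0r coefM big_ord1 subn0 v0 mulr0 //.
have dphi : eqm M phi^`() (texp rat M.+1).
  by rewrite /phi derivB derivC subr0; exact: texp_deriv.
rewrite deriv_comp derivM.
apply: eqm_trans (eqmM (eqm_leq (leqnSn M) D) dphi) _.
apply: (@eqm_trans _ _ _ (texp rat M.+1 * v + texp rat M.+1 * v^`())).
  by rewrite -mulrDr mulrC; exact: eqm_refl.
by apply: eqmD; [apply: eqmM; [exact/eqm_sym/texp_deriv | exact: eqm_refl] | exact: eqm_refl].
Qed.

Lemma vpoly_dvd M : 'X^2 %| vpoly M.
Proof.
by apply/dvdXnP => i i2; rewrite coef_poly /coefv i2 mul0r; case: ifP.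
Qed.

Lemma dvpoly_dvd M : 'X^1 %| (vpoly M)^`().
Proof.
have /dvdpP[u ->] := vpoly_dvd M; apply/dvdpP; exists (u^`() * 'X + u *+ 2).
by rewrite derivM derivXn /= !exprS; ring.
Qed.

Lemma eqm_mul_vpoly L M p q : eqm M p q -> eqm M.+2 (vpoly L * p) (vpoly L * q).
Proof.
move=> pq; rewrite /eqm -mulrBr -addn2 addnC exprD.
exact: dvdp_mul (vpoly_dvd L) pq.
Qed.

Local Notation V L := (expop (vpoly L) 0 L).
Local Notation W L := (expop (vpoly L) (vpoly L)^`() L).

(** Modulo X^L, exp(V) respects sums and products and fixes constants, so it is the substitution of
    exp(V) x for x. *)
Lemma expV_comp L p : eqm L (V L p) (p \Po V L 'X).
Proof.
have d0 : 'X^1 %| (0 : {poly rat}) by rewrite dvdp0.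
have VM q r : eqm L (V L (q * r)) (V L q * V L r).
  by have := expopM q r L (vpoly_dvd L) d0 d0; rewrite addr0.
elim/poly_ind: p => [|p c IH].
  rewrite comp_poly0 (_ : V L 0 = 0); first exact: eqm_refl.
  by have := expopZ (vpoly L) 0 L 0 0; rewrite !scale0r.
rewrite expopD comp_polyD comp_polyM comp_polyX comp_polyC; apply: eqmD.
  apply: eqm_trans (VM p 'X) _; apply: eqmM => //; exact: eqm_refl.
rewrite /expop; case: L {VM IH d0} => [|L]; first by apply/eqmP.
rewrite big_ord_recl big1 => [|i _]; first by rewrite invr1 scale1r addr0; exact: eqm_refl.
rewrite lift0 iterSr /diffop derivC mul0r mulr0 subrr.
by have := iter_diffopZ (vpoly L.+1) 0 i 0 0; rewrite !scale0r => ->; rewrite scaler0.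
Qed.

Lemma vpoly_lead L : (0 < L)%N -> eqm 3 (vpoly L.+1) (2%:R^-1 *: 'X^2).
Proof.
case: L => // L _; apply/eqmP=> -[|[|[|i]]] // _; rewrite coef_poly coefZ coefXn /= /coefv /=;
  rewrite ?mul0r ?mulr0 //.
by rewrite mulr1 K1 mul1r.
Qed.

Lemma expop_lead L (v w p q : {poly rat}) : 'X^2 %| v -> 'X^1 %| w -> 'X^1 %| p ->
  eqm 3 (p + diffop v w p) q -> eqm 3 (expop v w L.+2 p) q.
Proof.
move=> v2 w1 p1; apply: eqm_trans; rewrite /expop 2!big_ord_recl /= invr1 !scale1r addrA.
rewrite -[X in eqm _ _ X]addr0; apply: eqmD; first exact: eqm_refl.
rewrite /eqm subr0; apply: (big_ind (fun x => 'X^3 %| x)) => [|x y|i _]; first by rewrite dvdp0.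
  exact: dvdp_add.
rewrite -mul_polyC dvdp_mull //.
apply: dvdp_trans (iter_diffop_dvd v2 w1 i.+2 p1).
by rewrite dvdp_exp2l // addn1.
Qed.

Lemma expV_X L : (1 < L)%N -> eqm L (V L.+1 'X) (texp rat L.+1 - 1).
Proof.
move=> L1; have d0 : 'X^1 %| (0 : {poly rat}) by rewrite dvdp0.
have lead_phi : eqm 3 (texp rat L.+1 - 1) ('X + 2%:R^-1 *: 'X^2).
  by case: L L1 => [|[|L]] // _; apply/eqmP=> -[|[|[|i]]] // _;
    rewrite !(coefN, coefD, coefZ, coefX, coefXn, coef1, coef_poly) /=;
    rewrite ?invr1 ?subrr ?mulr0 ?mulr1 ?subr0 ?addr0 ?add0r.
apply: (@julia_unique rat L (vpoly L.+1)) => //; first exact: vpoly_lead (ltnW L1).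
- case: L L1 {lead_phi} => // L _; apply: expop_lead; rewrite ?vpoly_dvd //.
  rewrite /diffop derivX mulr1 mul0r subr0; apply: eqmD; [exact: eqm_refl | exact: vpoly_lead].
(* V x = v, and V commutes with its exponential: exp(V) v = V (exp(V) x) = v psi'. By [expV_comp]
   the left side is also v(psi). *)
- have E : V L.+1 (vpoly L.+1) = vpoly L.+1 * (V L.+1 'X)^`().
    have := diffop_expop (vpoly L.+1) 0 L.+1 'X.
    by rewrite {1}/diffop mul0r subr0 => ->; rewrite /diffop derivX mulr1 mul0r subr0.
  by rewrite -E; apply: eqm_sym; exact: expV_comp.
- apply: eqm_trans (vpoly_julia L) _; rewrite mulrC; apply: eqm_leq (leqnSn _) _.
  apply: eqm_mul_vpoly; rewrite derivB derivC subr0; exact/eqm_sym/texp_deriv.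
Qed.

(* [W (g h) = W g h + g V h] and [W v = 0] give [v = exp W 1 * exp V v], and
   [exp V v = v (e^x - 1) = e^x v] by the Julia equation; cancel [v]. *)
Lemma expW_1 L : (0 < L)%N ->
  eqm L (W L.+2 1) (\poly_(i < L.+2) ((-1) ^+ i / i`!%:R)).
Proof.
move=> L0; set v := vpoly L.+2; set e := texp rat L.+2.
have d0 : 'X^1 %| (0 : {poly rat}) by rewrite dvdp0.
have VvE : eqm L.+2 (V L.+2 v) (v * e).
  have := diffop_expop v 0 L.+2 'X.
  rewrite {1}/diffop mul0r subr0 {1}/diffop derivX mulr1 mul0r subr0 => <-.
  apply: eqm_mul_vpoly; apply: (@eqm_trans _ _ _ (e - 1)^`()).
    by apply: eqm_deriv; exact: expV_X.
  by rewrite derivB derivC subr0; apply: eqm_leq (leqnSn _) _; exact: texp_deriv.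
have WvE : W L.+2 v = v.
  rewrite /expop big_ord_recl big1 ?addr0 => [|i _]; first by rewrite invr1 scale1r.
  rewrite lift0 iterSr {2}/diffop mulrC subrr.
  by have := iter_diffopZ v v^`() i 0 0; rewrite !scale0r => ->; rewrite scaler0.
have P : eqm L.+2 (W L.+2 1 * (v * e)) v.
  have := expopM 1 v L.+2 (vpoly_dvd L.+2) (dvpoly_dvd L.+2) d0.
  rewrite addr0 mul1r WvE => /eqm_sym H.
  exact: eqm_trans (eqmM (eqm_refl _ _) (eqm_sym VvE)) H.
(* v = X^2 u with u(0) = K_1/2 nonzero: u is coprime to X, and cancelling X^2 lowers the modulus
   from L + 2 to L. *)
have {}P : eqm L (W L.+2 1 * e) 1.
  move: P; rewrite /eqm (_ : _ - v = v * (W L.+2 1 * e - 1)); last by ring.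
  have /dvdpP[u uE] : 'X^2 %| v by exact: vpoly_dvd.
  have u0 : u`_0 != 0.
    have := coefMXn 2 u 2; rewrite -uE /= => <-.
    by rewrite coef_vpoly // /coefv /= K1 mul1r.
  rewrite uE mulrC mulrA -addn2 exprD dvdp_mul2r ?monic_neq0 ?monicXn //.
  rewrite Gauss_dvdpl //; apply: coprimep_expl.
  by rewrite coprimep_sym coprimepX rootE horner_coef0.
set en := \poly_(i < _) _.
have en1 : eqm L (e * en) 1 by apply: eqm_leq (texpN rat L.+2); rewrite ltnW.
apply: (@eqm_trans _ _ _ (W L.+2 1 * (e * en))).
  by rewrite -[X in eqm _ X _]mulr1; apply: eqmM; [exact: eqm_refl | exact: eqm_sym].
by rewrite mulrA -[X in eqm _ _ X]mul1r; apply: eqmM => //; exact: eqm_refl.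
Qed.

End KoszulNumbers.

(** * The exponential on weights *)

(** The bound k + l is that of [dsum] in component k + l - 1, where E_(k,l) lives. *)
Definition wstep (R : fieldType) (K : nat -> R) (c : nat -> nat -> R) k l : R :=
  - \sum_(m < k + l) K m.+1 * wrho m.+1 c k l.

Section Sequences.
Variable K : nat -> rat.

(** [vseq] and [wseq] are V and W acting on the numbers k! [x^k], as [vseq_poly] and [wseq_poly]
    make precise. *)
Definition vseq (a : nat -> rat) k : rat :=
  \sum_(m < k) K m.+1 * 'C(k, m.+2)%:R * a (k - m.+1)%N.

Definition wseq (b : nat -> rat) l : rat :=
  \sum_(m < l) K m.+1 * ('C(l, m.+2)%:R - 'C(l, m.+1)%:R) * b (l - m.+1)%N.

Definition tens (a b : nat -> rat) (k l : nat) : rat := a k * b l.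

(** Each term of [wrho] shifts only one of the two indices, so V and W act on separate factors and
    the exponential of V + W factors. *)
Lemma wstep_tens a b : wstep K (tens a b) = tens (vseq a) b + tens a (wseq b).
Proof.
apply/funext => k; apply/funext => l; rewrite /wstep /tens.
rewrite -[RHS]/(vseq a k * b l + a k * wseq b l).
have -> : vseq a k = \sum_(m < k + l) K m.+1 * 'C(k, m.+2)%:R * a (k - m.+1)%N.
  rewrite /vseq (big_ord_widen (k + l)
    (fun m => K m.+1 * 'C(k, m.+2)%:R * a (k - m.+1)%N)) ?leq_addr //.
  rewrite big_mkcond; apply: eq_bigr => m _; case: ltnP => // km.
  by rewrite bin_small ?mulr0 ?mul0r //; lia.
have -> : wseq b l = \sum_(m < k + l) K m.+1 * ('C(l, m.+2)%:R - 'C(l, m.+1)%:R) * b (l - m.+1)%N.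
  rewrite /wseq (big_ord_widen (k + l)
    (fun m => K m.+1 * ('C(l, m.+2)%:R - 'C(l, m.+1)%:R) * b (l - m.+1)%N)) ?leq_addl //.
  rewrite big_mkcond; apply: eq_bigr => m _; case: ltnP => // km.
  by rewrite !bin_small ?subrr ?mulr0 ?mul0r //; lia.
rewrite mulr_suml mulr_sumr -big_split -sumrN; apply: eq_bigr => m _ /=.
by rewrite /wrho; ring.
Qed.

Lemma wstepD : {morph wstep K : c d / c + d}.
Proof.
move=> c d; apply/funext => k; apply/funext => l.
rewrite -[RHS]/(wstep K c k l + wstep K d k l) /wstep -opprD -big_split.
congr (- _); apply: eq_bigr => m _; rewrite /wrho /=.
rewrite -[(c + d) k (l - m.+1)%N]/(c k (l - m.+1)%N + d k (l - m.+1)%N).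
by rewrite -[(c + d) (k - m.+1)%N l]/(c (k - m.+1)%N l + d (k - m.+1)%N l); ring.
Qed.

(** Since X^2 divides v, coefficient k of v p' involves p only up to degree k - 1, so no precision
    is lost under iteration. *)
Lemma vseq_poly L M (a : nat -> rat) (p : {poly rat}) : (M <= L.+1)%N ->
  (forall i, (i < M)%N -> a i = i`!%:R * p`_i) ->
  forall k, (k < M)%N -> vseq a k = k`!%:R * (diffop (vpoly K L) 0 p)`_k.
Proof.
move=> ML ap k kM; rewrite /diffop mul0r subr0 coefM mulr_sumr.
case: k kM => [|k] kM.
  by rewrite /vseq big_ord0 big_ord1 coef_vpoly // !mul0r mulr0.
rewrite /vseq big_ord_recr /= bin_small // mulr0 mul0r addr0.
have /dvdXnP v01 := vpoly_dvd K L.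
rewrite 2!big_ord_recl /= !v01 // !mul0r !mulr0 !add0r; apply: eq_bigr => m _; have mk := ltn_ord m.
rewrite /bump !add1n coef_vpoly; last by lia.
rewrite coef_deriv ap; last by lia.
move: (nat_of_ord m) mk => {}m mk.
have [t tE] : exists t, k = (m + t.+1)%N by exists (k - m).-1; lia.
rewrite tE !subSS -addSnnS addKn (_ : m.+1 + t - m = t.+1)%N; last by lia.
have le : (m.+2 <= (m.+1 + t).+1)%N by lia.
rewrite -(bin_fact le) subSS addKn (_ : coefv K m.+2 = K m.+1) //.
have := fact_gt0 m.+2; move: (m.+2)`! => x x0.
rewrite factS -[_ *+ t.+1]mulr_natr !natrM; field.
by rewrite Num.Theory.pnatr_eq0 -lt0n.
Qed.

(** The bound is one lower than in [vseq_poly]: the derivative of the truncated v is correct only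
    below degree L. *)
Lemma wseq_poly L M (b : nat -> rat) (p : {poly rat}) : (M <= L)%N ->
  (forall i, (i < M)%N -> b i = i`!%:R * p`_i) ->
  forall l, (l < M)%N -> wseq b l = l`!%:R * (diffop (vpoly K L) (vpoly K L)^`() p)`_l.
Proof.
move=> ML bp l lM.
have E : wseq b l = vseq b l - \sum_(m < l) K m.+1 * 'C(l, m.+1)%:R * b (l - m.+1)%N.
  rewrite -sumrB; apply: eq_bigr => m _; ring.
rewrite E (vseq_poly (leqW ML) bp lM) /diffop mul0r subr0 coefB mulrBr; congr (_ - _).
rewrite coefM big_ord_recl coef_dvpoly; last by rewrite /=; lia.
rewrite /= !mul0r add0r mulr_sumr; apply: eq_bigr => m _; have ml := ltn_ord m.
rewrite /bump add1n coef_dvpoly /=; last by lia.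
rewrite bp; last by lia.
rewrite -(bin_fact ml); have := fact_gt0 m.+1; move: (m.+1)`! => x x0.
by rewrite !natrM; field; rewrite Num.Theory.pnatr_eq0 -lt0n.
Qed.

Lemma iter_vseq L j k : (k < L.+1)%N ->
  iter j vseq (fun k => (k == 1%N)%:R) k = k`!%:R * (iter j (diffop (vpoly K L) 0) 'X)`_k.
Proof.
elim: j k => [|j IH] k kL; last by apply: vseq_poly IH _ kL.
by rewrite /= coefX; case: eqP => [->|]; rewrite ?mulr1 ?mulr0.
Qed.

Lemma iter_wseq L j k : (k < L)%N ->
  iter j wseq (fun k => (k == 0%N)%:R) k =
  k`!%:R * (iter j (diffop (vpoly K L) (vpoly K L)^`()) 1)`_k.
Proof.
elim: j k => [|j IH] k kL; last by apply: wseq_poly IH _ kL.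
by rewrite /= coef1; case: eqP => [->|]; rewrite ?mulr1 ?mulr0.
Qed.

Hypotheses (K1 : K 1%N = 1)
  (KS : forall n : nat, (2 <= n)%N ->
     K n = - 2%:R / ((n%:R + 2%:R) * (n%:R - 1)) *
           \sum_(1 <= i < n) stirling2 n.+1 i * K i).

Lemma coef_iter_diffop0 L (w p : {poly rat}) j d k : 'X^1 %| w -> 'X^d %| p -> (k < j + d)%N ->
  (iter j (diffop (vpoly K L) w) p)`_k = 0.
Proof.
move=> w1 pd kj; have /dvdXnP := iter_diffop_dvd (vpoly_dvd K L) w1 j pd; exact.
Qed.

Lemma wstep_exp n k l : (0 < k)%N -> (k + l = n.+1)%N ->
  \sum_(j < n.+1) (j`!%:R)^-1 *
    iter j (wstep K) (fun k j => ((k == 1%N) && (j == 0%N))%:R) k l = (-1) ^+ l.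
Proof.
(* [expV_X] gives the coefficients of exp(V) x below degree L - 1 and [expW_1] those of exp(W) 1
   below L - 2, while k <= n + 1 and l <= n. *)
move=> k0 kl; pose L := n.+4.
pose t i j := iter i vseq (fun k => (k == 1%N)%:R) k * iter j wseq (fun k => (k == 0%N)%:R) l.
have d0 : 'X^1 %| (0 : {poly rat}) by rewrite dvdp0.
(* V^i x has order at least i + 1 and W^j 1 order at least j; with k + l = n + 1 only i + j <= n
   contributes. *)
have tV i : (k <= i)%N -> iter i vseq (fun k => (k == 1%N)%:R) k = 0.
  move=> ki; rewrite (iter_vseq (L := L)); last by rewrite /L; lia.
  by rewrite (@coef_iter_diffop0 _ _ _ _ 1) ?mulr0 // addn1 ltnS.
have tW j : (l < j)%N -> iter j wseq (fun k => (k == 0%N)%:R) l = 0.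
  move=> lj; rewrite (iter_wseq (L := L)); last by rewrite /L; lia.
  by rewrite (@coef_iter_diffop0 _ _ _ _ 0) ?mulr0 ?dvpoly_dvd ?addn0 // expr0 dvd1p.
transitivity (\sum_(j < n.+1) (j`!%:R)^-1 * \sum_(i < j.+1) t i (j - i)%N *+ 'C(j, i)).
  apply: eq_bigr => j _; congr (_ * _).
  have -> : (fun k j => ((k == 1%N) && (j == 0%N))%:R) =
      tens (fun k => (k == 1%N)%:R) (fun k => (k == 0%N)%:R).
    by apply/funext => x; apply/funext => y; rewrite /tens; case: eqP; rewrite ?mul1r ?mul0r.
  rewrite (iter_leibniz wstepD wstep_tens).
  rewrite (big_morph (fun c : nat -> nat -> rat => c k l) (id1 := 0) (op1 := +%R)) //.
  apply: eq_bigr => i _; move: ('C(j, i)) => N.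
  by elim: N => [|N IH]; rewrite ?mulr0n // !mulrS -IH.
rewrite exp_conv => [|i j ij]; last first.
  have [ki|ik] := leqP k i; first by rewrite /t tV ?mul0r.
  by rewrite /t tW ?mulr0 //; lia.
have trunc (g : nat -> rat) : (forall i, (n < i)%N -> g i = 0) ->
    \sum_(i < n.+1) g i = \sum_(i < L) g i.
  move=> g0; rewrite (big_ord_widen L g) /L ?ltnS 1?ltnW //; last by lia.
  by rewrite big_mkcond; apply: eq_bigr => i _; case: ltnP => // /g0.
transitivity ((\sum_(i < n.+1) (i`!%:R)^-1 * iter i vseq (fun k => (k == 1%N)%:R) k) *
    \sum_(j < n.+1) (j`!%:R)^-1 * iter j wseq (fun k => (k == 0%N)%:R) l).
  rewrite mulr_suml; apply: eq_bigr => i _; rewrite mulr_sumr; apply: eq_bigr => j _.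
  by rewrite /t; ring.
rewrite (trunc (fun i => (i`!%:R)^-1 * iter i vseq (fun k => (k == 1%N)%:R) k)); last first.
  by move=> i ni; rewrite tV ?mulr0 //; lia.
rewrite (trunc (fun i => (i`!%:R)^-1 * iter i wseq (fun k => (k == 0%N)%:R) l)); last first.
  by move=> i ni; rewrite tW ?mulr0 //; lia.
transitivity ((k`!%:R * (expop (vpoly K L) 0 L 'X)`_k) *
    (l`!%:R * (expop (vpoly K L) (vpoly K L)^`() L 1)`_l)).
  rewrite !coef_expop [k`!%:R * _]mulr_sumr [l`!%:R * _]mulr_sumr; congr (_ * _);
    apply: eq_bigr => i _.
    by rewrite (iter_vseq (L := L)); [ring | rewrite /L; lia].
  by rewrite (iter_wseq (L := L)); [ring | rewrite /L; lia].
rewrite (eqmE (expV_X K1 KS _)) //; last by lia.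
rewrite (eqmE (expW_1 K1 KS _)) //; last by lia.
have kL : (k < L)%N by rewrite /L; lia.
have lL : (l < L)%N by rewrite /L; lia.
rewrite coefB !coef_poly coef1 kL lL eqn0Ngt k0 subr0 divff ?fact_unit // mul1r.
by rewrite mulrCA divff ?fact_unit ?mulr1.
Qed.
End Sequences.

(** * From rational weights to operators over the field *)

(** Nonzero integers are invertible in [F], so [ratr] can be computed from any fraction, reduced or
    not ([ratrE]); common denominators then give both morphism laws. *)
Lemma pchar0_ratr (F : fieldType) : [pchar F] =i pred0 ->
  exists g : {rmorphism rat -> F}, g =1 ratr.
Proof.
move=> /pcharf0P char0.
have int0 (d : int) : d != 0 -> d%:~R != 0 :> F.
  by case: d => n; rewrite ?NegzE ?mulrNz ?oppr_eq0 -pmulrn char0.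
have ratrE (a b : int) : b != 0 -> ratr (a%:~R / b%:~R) = a%:~R / b%:~R :> F.
  move=> b0; set x := _ / _; have bq : b%:~R != 0 :> rat by rewrite intr_eq0.
  have : (numq x)%:~R * b%:~R = a%:~R * (denq x)%:~R :> rat.
    have := divq_num_den x; have dq : (denq x)%:~R != 0 :> rat by rewrite intr_eq0 denq_eq0.
    rewrite {3}/x => /eqP; rewrite eqr_div // => /eqP ->; by rewrite mulrC.
  rewrite -!rmorphM => /intr_inj /(congr1 (fun z : int => z%:~R : F)).
  rewrite !rmorphM /= => H; apply/eqP; rewrite eqr_div ?int0 ?denq_eq0 //.
  by apply/eqP.
have rB : zmod_morphism (@ratr F).
  move=> x y; rewrite -[x]divq_num_den -[y]divq_num_den.
  have [dx dy] : denq x != 0 /\ denq y != 0 by rewrite !denq_eq0.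
  move: (numq x) (denq x) (numq y) (denq y) dx dy => a b c d b0 d0.
  rewrite (_ : _ - _ = (a * d - c * b)%:~R / (b * d)%:~R); last first.
    rewrite rmorphB !rmorphM /=; field; by rewrite !intr_eq0 ?b0 ?d0.
  rewrite !ratrE ?mulf_neq0 // rmorphB !rmorphM /=; field.
  by rewrite !int0 ?b0 ?d0.
have rM : monoid_morphism (@ratr F).
  split=> [|x y]; first by have := ratrE 1 1 isT; rewrite !mulr1z !divr1.
  rewrite -[x]divq_num_den -[y]divq_num_den.
  have [dx dy] : denq x != 0 /\ denq y != 0 by rewrite !denq_eq0.
  move: (numq x) (denq x) (numq y) (denq y) dx dy => a b c d b0 d0.
  rewrite (_ : _ * _ = (a * c)%:~R / (b * d)%:~R); last first.
    rewrite !rmorphM /=; field; by rewrite !intr_eq0 ?b0 ?d0.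
  rewrite !ratrE ?mulf_neq0 // !rmorphM /=; field.
  by rewrite !int0 ?b0 ?d0.
pose addM := GRing.isZmodMorphism.Build rat F (@ratr F) rB.
pose mulM := GRing.isMonoidMorphism.Build rat F (@ratr F) rM.
pose g : {rmorphism rat -> F} := HB.pack (@ratr F) addM mulM.
by exists g.
Qed.

Lemma iter_wstep_rmorph (R S : fieldType) (g : {rmorphism R -> S}) K c j k l :
  iter j (wstep (fun n => g (K n))) (fun k l => g (c k l)) k l =
  g (iter j (wstep K) c k l).
Proof.
elim: j k l => //= j IH k l; rewrite /wstep rmorphN rmorph_sum; congr (- _).
apply: eq_bigr => m _; rewrite /wrho !IH rmorphM rmorphB !rmorphM rmorphB.
by rewrite !rmorph_nat.
Qed.

Section Operators.
Variables (F : fieldType) (A : comSuperAlgType F) (f : {linear A -> A}).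

Lemma rho_comb_weighted K c :
  - rho_comb K (weighted f c) = weighted f (wstep K c).
Proof.
apply: functional_extensionality_dep => n.
rewrite DA_oppE /rho_comb /dsum /weighted.
under eq_bigr => m _ do rewrite DA_scaleE rho_weighted /weighted scaler_sumr.
rewrite exchange_big -sumrN; apply: eq_bigr => k _ /=.
rewrite /wstep addSn subnKC -1?ltnS // scaleNr scaler_suml; congr (- _).
by apply: eq_bigr => m _; rewrite scalerA.
Qed.

Lemma iter_rho_comb K c j :
  iter j (fun w => - rho_comb K w) (weighted f c) = weighted f (iter j (wstep K) c).
Proof. by elim: j => //= j ->; exact: rho_comb_weighted. Qed.

End Operators.

Theorem theorem2p1 (F : fieldType) (A : comSuperAlgType F) (K : nat -> rat)
    (charF : [pchar F] =i pred0)
    (K1 : K 1%N = 1)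
    (KS : forall n : nat, (2 <= n)%N ->
       K n = - 2%:R / ((n%:R + 2%:R) * (n%:R - 1)) *
             \sum_(1 <= i < n) stirling2 n.+1 i * K i)
    (f : {linear A -> A}) :
  dsum (fun i => inD (Phi f i)) =
  dexp (fun w => - rho_comb (fun n => ratr (K n)) w) (inD (opD f)).
Proof.
have [g gE] := pchar0_ratr charF.
apply: functional_extensionality_dep => n.
rewrite /dexp /dsum (bigD1 ord_max) //= big1 ?addr0 => [|i im]; last first.
  by rewrite inD_neq.
rewrite inD_eq PhiD_weighted opD_weighted [in LHS]/weighted.
under [RHS]eq_bigr => k _ do rewrite iter_rho_comb DA_scaleE /weighted scaler_sumr.
rewrite exchange_big; apply: eq_bigr => k _ /=.
under eq_bigr => j _ do rewrite scalerA.
(* It suffices to match the coefficients of each [PhiD f n k.+1], which is [wstep_exp] at first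
   index k + 1 and l = n - k, carried along [g]. *)
rewrite -scaler_suml; congr (_ *: _).
have nk : (k.+1 + (n - k) = n.+1)%N by rewrite addSn subnKC // -ltnS.
rewrite -[LHS](rmorph_sign g) -(wstep_exp K1 KS (ltn0Sn k) nk) rmorph_sum.
apply: eq_bigr => j _ /=; rewrite rmorphM fmorphV rmorph_nat; congr (_ * _).
rewrite -iter_wstep_rmorph.
have -> : (fun n => ratr (K n)) = (fun n => g (K n)) by apply/funext => i; rewrite gE.
congr (iter _ _ _ _ _); apply/funext => x; apply/funext => y.
by rewrite rmorph_nat.
Qed.
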